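(* (i) $\mathcal Z(\mathfrak q(n))=\mathcal Z(\mathfrak{sq}(n))$ for $n\ge2$. (ii) $\mathcal Z(\mathfrak{pq}(n))=\mathcal Z(\mathfrak{psq}(n))$ for $n\ge3$. Here $\mathcal U(\mathfrak{sq}(n))$ is viewed as a subalgebra of $\mathcal U(\mathfrak q(n))$ and $\mathcal U(\mathfrak{psq}(n))$ as a subalgebra of $\mathcal U(\mathfrak{pq}(n))$.
   Context: The base field is $\mathbb C$. For $n\times n$ matrices $A,B$ put $X_{A,B}=\begin{pmatrix}A&B\\ B&A\end{pmatrix}$. The Lie superalgebra $\mathfrak q(n)=\{X_{A,B}\}$ has even part $\{X_{A,0}\}$, odd part $\{X_{0,B}\}$ and brackets $[X_{A,0},X_{A',0}]=X_{[A,A'],0}$, $[X_{A,0},X_{0,B}]=X_{0,[A,B]}$, $[X_{0,B},X_{0,B'}]=X_{BB'+B'B,0}$. Put $\mathfrak{sq}(n)=\{X_{A,B}:\operatorname{tr}B=0\}$, $\mathfrak{pq}(n)=\mathfrak q(n)/\mathbb C\,\mathrm{Id}$, $\mathfrak{psq}(n)=\mathfrak{sq}(n)/\mathbb C\,\mathrm{Id}$. For a Lie superalgebra $\mathfrak p$, $\mathcal Z(\mathfrak p)$ denotes the (super)centre of $\mathcal U(\mathfrak p)$: the elements whose supercommutator with every element of $\mathfrak p$ vanishes. *)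

(* Defs.v *)
From HB Require Import structures.
From mathcomp Require Import all_boot all_order all_algebra.
From mathcomp Require Import generic_quotient ring_quotient.
From mathcomp Require Import boolp classical_sets reals.
From mathcomp Require Import ring.
From mathcomp Require Export complex.

Set Implicit Arguments.
Unset Strict Implicit.
Unset Printing Implicit Defensive.

Import Order.TTheory GRing.Theory Num.Theory.

Local Open Scope ring_scope.
Local Open Scope quotient_scope.

(******************************************************************************)
(* Lie superalgebras                                                          *)
(*                                                                            *)
(* Parities are booleans, added with (+); multiplication of parities is &&.   *)
(* The Z/2-grading is given by the two projections: hpart false (even part)   *)
(* and hpart true (odd part).  The elements of the form hpart d x are exactly *)
(* the homogeneous elements of parity d, so that the axioms below are the     *)
(* usual ones on homogeneous elements.                                        *)
(******************************************************************************)

HB.mixin Record Lmodule_isLieSuper (K : numFieldType) L of GRing.Lmodule K L := {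
  hpart : bool -> L -> L;
  sbr : L -> L -> L;
  hpart_is_linear : forall d, linear (hpart d);
  hpart_proj : forall a b x,
    hpart a (hpart b x) = if a == b then hpart a x else 0;
  hpart_sum : forall x, hpart false x + hpart true x = x;
  sbr_is_linearr : forall x, linear (sbr x);
  sbr_is_linearl : forall y, linear (sbr^~ y);
  sbr_graded : forall a b x y,
    hpart (a (+) b) (sbr (hpart a x) (hpart b y)) = sbr (hpart a x) (hpart b y);
  sbr_skew : forall a b x y,
    sbr (hpart a x) (hpart b y)
      = - ((-1) ^+ (a && b) *: sbr (hpart b y) (hpart a x));
  sbr_jacobi : forall a b x y z,
    sbr (hpart a x) (sbr (hpart b y) z)
      = sbr (sbr (hpart a x) (hpart b y)) z
        + (-1) ^+ (a && b) *: sbr (hpart b y) (sbr (hpart a x) z)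
}.

#[short(type="lieSuperType")]
HB.structure Definition LieSuper (K : numFieldType) :=
  {L of GRing.Lmodule K L & Lmodule_isLieSuper K L}.

Section LieSuperTheory.
Variables (K : numFieldType) (L : lieSuperType K).

HB.instance Definition _ d :=
  GRing.isLinear.Build K L L *:%R (@hpart K L d) (@hpart_is_linear K L d).

HB.instance Definition _ x :=
  GRing.isLinear.Build K L L *:%R (@sbr K L x) (@sbr_is_linearr K L x).

Lemma sbrDl (x y z : L) : sbr (x + y) z = sbr x z + sbr y z.
Proof. by have := sbr_is_linearl z 1 x y; rewrite !scale1r. Qed.

Lemma sbr0l (z : L) : sbr 0 z = 0.
Proof. by apply: (addrI (sbr 0 z)); rewrite -sbrDl !addr0. Qed.

Lemma sbrZl c (x z : L) : sbr (c *: x) z = c *: sbr x z.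
Proof. by have := sbr_is_linearl z c x 0; rewrite addr0 sbr0l addr0. Qed.

End LieSuperTheory.

Definition lsmorph (K : numFieldType) (L1 L2 : lieSuperType K) (f : L1 -> L2) :=
  [/\ linear f, forall d x, f (hpart d x) = hpart d (f x)
    & forall x y, f (sbr x y) = sbr (f x) (f y)].

Record lieIdeal (K : numFieldType) (L : lieSuperType K) := LieIdeal {
  ideal_pred :> L -> bool;
  ideal_submod : submod_closed ideal_pred;
  ideal_hpart : forall d x, x \in ideal_pred -> hpart d x \in ideal_pred;
  ideal_sbr : forall x y, y \in ideal_pred -> sbr x y \in ideal_pred
}.

HB.instance Definition _ (K : numFieldType) (L : lieSuperType K)
    (I : lieIdeal L) :=
  GRing.isSubmodClosed.Build K L (ideal_pred I)
    (GRing.submod_closed_semi (ideal_submod I)).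

Definition lquot (K : numFieldType) (L : lieSuperType K) (I : lieIdeal L) :=
  Quotient.quot (GRing.ZmodClosed.clone L (ideal_pred I) _).

Section LieQuotient.
Variables (K : numFieldType) (L : lieSuperType K) (I : lieIdeal L).

HB.instance Definition _ := GRing.Zmodule.on (lquot I).
HB.instance Definition _ := Quotient.on (lquot I).

Definition lpi (x : L) : lquot I := \pi_(lquot I) x.

Lemma lpiP x y : lpi x = lpi y <-> x - y \in ideal_pred I.
Proof.
rewrite Quotient.idealrBE; split; first by move=> h; apply/eqP.
by move/eqP.
Qed.

Lemma lpiK u : lpi (repr u) = u. Proof. exact: reprK. Qed.

Lemma lpiD x y : lpi (x + y) = lpi x + lpi y.
Proof. by rewrite /lpi; exact: (raddfD (\pi_(lquot I))). Qed.

Lemma lpi_surj u : exists x, u = lpi x.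
Proof. by exists (repr u); rewrite lpiK. Qed.

Lemma repr_lpi x : repr (lpi x) - x \in ideal_pred I.
Proof. by apply/lpiP; rewrite lpiK. Qed.

Definition lscale (c : K) (u : lquot I) : lquot I := lpi (c *: repr u).

Lemma lpiZ c x : lscale c (lpi x) = lpi (c *: x).
Proof. by apply/lpiP; rewrite -scalerBr rpredZ // repr_lpi. Qed.

Fact lscaleA a b v : lscale a (lscale b v) = lscale (a * b) v.
Proof. by have [x ->] := lpi_surj v; rewrite !lpiZ scalerA. Qed.
Fact lscale1 : left_id 1 lscale.
Proof. by move=> v; have [x ->] := lpi_surj v; rewrite !lpiZ scale1r. Qed.
Fact lscaleDr : right_distributive lscale +%R.
Proof.
move=> c u v; have [x ->] := lpi_surj u; have [y ->] := lpi_surj v.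
by rewrite -lpiD !lpiZ scalerDr lpiD.
Qed.
Fact lscaleDl v : {morph lscale^~ v : a b / a + b}.
Proof.
by move=> a b; have [x ->] := lpi_surj v; rewrite !lpiZ scalerDl lpiD.
Qed.

HB.instance Definition _ := GRing.Zmodule_isLmodule.Build K (lquot I)
  lscaleA lscale1 lscaleDr lscaleDl.

Fact lpi_is_linear : linear lpi.
Proof. by move=> c x y; rewrite lpiD -lpiZ. Qed.

HB.instance Definition _ :=
  GRing.isLinear.Build K L (lquot I) *:%R lpi lpi_is_linear.

Definition lq_hpart d (u : lquot I) : lquot I := lpi (hpart d (repr u)).
Definition lq_sbr (u v : lquot I) : lquot I := lpi (sbr (repr u) (repr v)).

Lemma lpi_hpart d x : lq_hpart d (lpi x) = lpi (hpart d x).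
Proof. by apply/lpiP; rewrite -linearB; apply: ideal_hpart; exact: repr_lpi. Qed.

Lemma ideal_sbrl x y : x \in ideal_pred I -> sbr x y \in ideal_pred I.
Proof.
move=> Ix; rewrite -[x]hpart_sum -[y]hpart_sum !sbrDl !linearD /=.
have sw a b : sbr (hpart a x) (hpart b y) \in ideal_pred I.
  rewrite sbr_skew rpredN rpredZ //; apply: ideal_sbr; exact: ideal_hpart.
by rewrite !rpredD.
Qed.

Lemma lpi_sbr x y : lq_sbr (lpi x) (lpi y) = lpi (sbr x y).
Proof.
apply/lpiP; rewrite -(addrNK (sbr (repr (lpi x)) y) (sbr _ _)) -addrA.
rewrite rpredD //.
  by rewrite -linearB; apply: ideal_sbr; exact: repr_lpi.
rewrite -scaleN1r -sbrZl scaleN1r -sbrDl; apply: ideal_sbrl; exact: repr_lpi.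
Qed.

Fact lq_hpart_is_linear d : linear (lq_hpart d).
Proof.
move=> c u v; have [x ->] := lpi_surj u; have [y ->] := lpi_surj v.
by rewrite -linearP !lpi_hpart !linearP.
Qed.
Fact lq_hpart_proj a b u :
  lq_hpart a (lq_hpart b u) = if a == b then lq_hpart a u else 0.
Proof.
have [x ->] := lpi_surj u; rewrite !lpi_hpart hpart_proj.
by case: ifP => // _; rewrite linear0.
Qed.
Fact lq_hpart_sum u : lq_hpart false u + lq_hpart true u = u.
Proof.
by have [x ->] := lpi_surj u; rewrite !lpi_hpart -linearD hpart_sum.
Qed.
Fact lq_sbr_linearr u : linear (lq_sbr u).
Proof.
move=> c v w; have [x ->] := lpi_surj u; have [y ->] := lpi_surj v.
by have [z ->] := lpi_surj w; rewrite -linearP !lpi_sbr !linearP.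
Qed.
Fact lq_sbr_linearl v : linear (lq_sbr^~ v).
Proof.
move=> c u w; have [x ->] := lpi_surj u; have [y ->] := lpi_surj v.
by have [z ->] := lpi_surj w; rewrite -linearP !lpi_sbr sbr_is_linearl linearP.
Qed.
Fact lq_sbr_graded a b u v :
  lq_hpart (a (+) b) (lq_sbr (lq_hpart a u) (lq_hpart b v))
  = lq_sbr (lq_hpart a u) (lq_hpart b v).
Proof.
have [x ->] := lpi_surj u; have [y ->] := lpi_surj v.
by rewrite (lpi_hpart a) (lpi_hpart b) lpi_sbr lpi_hpart sbr_graded.
Qed.
Fact lq_sbr_skew a b u v :
  lq_sbr (lq_hpart a u) (lq_hpart b v)
  = - ((-1) ^+ (a && b) *: lq_sbr (lq_hpart b v) (lq_hpart a u)).
Proof.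
have [x ->] := lpi_surj u; have [y ->] := lpi_surj v.
by rewrite !lpi_hpart !lpi_sbr sbr_skew linearN linearZ.
Qed.
Fact lq_sbr_jacobi a b u v w :
  lq_sbr (lq_hpart a u) (lq_sbr (lq_hpart b v) w)
  = lq_sbr (lq_sbr (lq_hpart a u) (lq_hpart b v)) w
    + (-1) ^+ (a && b) *: lq_sbr (lq_hpart b v) (lq_sbr (lq_hpart a u) w).
Proof.
have [x ->] := lpi_surj u; have [y ->] := lpi_surj v.
have [z ->] := lpi_surj w.
by rewrite !lpi_hpart !lpi_sbr sbr_jacobi linearD linearZ.
Qed.

HB.instance Definition _ := Lmodule_isLieSuper.Build K (lquot I)
  lq_hpart_is_linear lq_hpart_proj lq_hpart_sum lq_sbr_linearr lq_sbr_linearl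
  lq_sbr_graded lq_sbr_skew lq_sbr_jacobi.

Lemma lpi_lsmorph : lsmorph lpi.
Proof.
split; first exact: lpi_is_linear.
  by move=> d x; rewrite -lpi_hpart.
by move=> x y; rewrite -lpi_sbr.
Qed.

End LieQuotient.

(******************************************************************************)
(* The universal enveloping algebra                                           *)
(*                                                                            *)
(* It is presented by generators (the elements of L) and relations: ueqv is   *)
(* the least congruence on terms containing the axioms of unital associative  *)
(* K-algebras, the linearity of L -> U(L) and the relations                   *)
(*   [x, y] = x y - (-1)^(|x||y|) y x      for x, y homogeneous in L.         *)
(* The universal property is uin_repr, uliftP, ulift_in and ulift_uniq below. *)
(******************************************************************************)

Inductive uterm (K : numFieldType) (L : lieSuperType K) : Type :=
| UGen of L
| UZero
| UOne
| UAdd of uterm L & uterm L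
| UMul of uterm L & uterm L
| UScale of K & uterm L.

Arguments UZero {K L}.
Arguments UOne {K L}.

Inductive ueqv (K : numFieldType) (L : lieSuperType K) :
  uterm L -> uterm L -> Prop :=
| ueqv_refl s : ueqv s s
| ueqv_sym s t : ueqv s t -> ueqv t s
| ueqv_trans s t r : ueqv s t -> ueqv t r -> ueqv s r
| ueqv_add s s' t t' : ueqv s s' -> ueqv t t' -> ueqv (UAdd s t) (UAdd s' t')
| ueqv_mul s s' t t' : ueqv s s' -> ueqv t t' -> ueqv (UMul s t) (UMul s' t')
| ueqv_scale c s s' : ueqv s s' -> ueqv (UScale c s) (UScale c s')
| ueqv_addA s t r : ueqv (UAdd s (UAdd t r)) (UAdd (UAdd s t) r)
| ueqv_addC s t : ueqv (UAdd s t) (UAdd t s)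
| ueqv_add0 s : ueqv (UAdd UZero s) s
| ueqv_addN s : ueqv (UAdd (UScale (-1) s) s) UZero
| ueqv_mulA s t r : ueqv (UMul s (UMul t r)) (UMul (UMul s t) r)
| ueqv_mul1l s : ueqv (UMul UOne s) s
| ueqv_mul1r s : ueqv (UMul s UOne) s
| ueqv_mulDl s t r : ueqv (UMul (UAdd s t) r) (UAdd (UMul s r) (UMul t r))
| ueqv_mulDr s t r : ueqv (UMul s (UAdd t r)) (UAdd (UMul s t) (UMul s r))
| ueqv_scaleA a b s : ueqv (UScale a (UScale b s)) (UScale (a * b) s)
| ueqv_scale1 s : ueqv (UScale 1 s) s
| ueqv_scaleDr c s t : ueqv (UScale c (UAdd s t)) (UAdd (UScale c s) (UScale c t))
| ueqv_scaleDl a b s : ueqv (UScale (a + b) s) (UAdd (UScale a s) (UScale b s))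
| ueqv_scaleAl c s t : ueqv (UScale c (UMul s t)) (UMul (UScale c s) t)
| ueqv_scaleAr c s t : ueqv (UScale c (UMul s t)) (UMul s (UScale c t))
| ueqv_gen c x y : ueqv (UGen (c *: x + y)) (UAdd (UScale c (UGen x)) (UGen y))
| ueqv_br a b x y :
    ueqv (UGen (sbr (hpart a x) (hpart b y)))
         (UAdd (UMul (UGen (hpart a x)) (UGen (hpart b y)))
               (UScale (- (-1) ^+ (a && b))
                       (UMul (UGen (hpart b y)) (UGen (hpart a x))))).

HB.instance Definition _ K L := gen_eqMixin (@uterm K L).
HB.instance Definition _ K L := gen_choiceMixin (@uterm K L).

(* The relations which a linear map from L to an algebra must satisfy in      *)
(* order to extend to U(L).                                                   *)
Definition urepr (K : numFieldType) (L : lieSuperType K) (A : algType K)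
    (f : L -> A) :=
  linear f /\ forall a b x y,
    f (sbr (hpart a x) (hpart b y))
    = f (hpart a x) * f (hpart b y)
      - (-1) ^+ (a && b) *: (f (hpart b y) * f (hpart a x)).

Fixpoint ueval (K : numFieldType) (L : lieSuperType K) (A : algType K)
    (f : L -> A) (t : uterm L) : A :=
  match t with
  | UGen x => f x
  | UZero => 0
  | UOne => 1
  | UAdd s t => ueval f s + ueval f t
  | UMul s t => ueval f s * ueval f t
  | UScale c s => c *: ueval f s
  end.

Lemma ueval_eqv (K : numFieldType) (L : lieSuperType K) (A : algType K)
    (f : L -> A) (s t : uterm L) :
  urepr f -> ueqv s t -> ueval f s = ueval f t.
Proof.
move=> [flin fbr]; elim=> {s t} //=.
- by move=> s t r _ -> _ ->.
- by move=> s s' t t' _ -> _ ->.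
- by move=> s s' t t' _ -> _ ->.
- by move=> c s s' _ ->.
- by move=> s t r; rewrite addrA.
- by move=> s t; rewrite addrC.
- by move=> s; rewrite add0r.
- by move=> s; rewrite scaleN1r addNr.
- by move=> s t r; rewrite mulrA.
- by move=> s; rewrite mul1r.
- by move=> s; rewrite mulr1.
- by move=> s t r; rewrite mulrDl.
- by move=> s t r; rewrite mulrDr.
- by move=> a b s; rewrite scalerA.
- by move=> s; rewrite scale1r.
- by move=> c s t; rewrite scalerDr.
- by move=> a b s; rewrite scalerDl.
- by move=> c s t; rewrite scalerAl.
- by move=> c s t; rewrite scalerAr.
- by move=> a b x y; rewrite fbr scaleNr.
Qed.

Section UEA.
Variables (K : numFieldType) (L : lieSuperType K).

Definition ueqb (s t : uterm L) : bool := `[< ueqv s t >].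

Fact ueqb_equiv : equiv_class_of ueqb.
Proof.
split.
- by move=> s; apply/asboolP; exact: ueqv_refl.
- by move=> s t; apply/asboolP/asboolP; exact: ueqv_sym.
- move=> t s r /asboolP h1 /asboolP h2; apply/asboolP; exact: ueqv_trans h1 h2.
Qed.

Canonical ueqb_equiv_rel := EquivRelPack ueqb_equiv.
Canonical ueqb_encModRel := defaultEncModRel ueqb.

Definition uea := {eq_quot ueqb}.

HB.instance Definition _ := Choice.on uea.

Definition upi (t : uterm L) : uea := \pi_({eq_quot ueqb}) t.
Definition urep (u : uea) : uterm L := repr u.

Lemma upiP s t : upi s = upi t <-> ueqv s t.
Proof.
split; first by move/eqmodP/asboolP.
by move=> h; apply/eqmodP/asboolP.
Qed.

Lemma urepK u : upi (urep u) = u. Proof. exact: reprK. Qed.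

Lemma urep_upi t : ueqv (urep (upi t)) t.
Proof. by apply/upiP; rewrite urepK. Qed.

Definition uadd (u v : uea) := upi (UAdd (urep u) (urep v)).
Definition umul (u v : uea) := upi (UMul (urep u) (urep v)).
Definition uscale (c : K) (u : uea) := upi (UScale c (urep u)).
Definition uopp (u : uea) := uscale (-1) u.

Lemma upi_add s t : uadd (upi s) (upi t) = upi (UAdd s t).
Proof. by apply/upiP/ueqv_add; exact: urep_upi. Qed.
Lemma upi_mul s t : umul (upi s) (upi t) = upi (UMul s t).
Proof. by apply/upiP/ueqv_mul; exact: urep_upi. Qed.
Lemma upi_scale c s : uscale c (upi s) = upi (UScale c s).
Proof. by apply/upiP/ueqv_scale; exact: urep_upi. Qed.

Definition upiE := (upi_add, upi_mul, upi_scale).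

Fact uaddA : associative uadd.
Proof.
move=> u v w; rewrite -[u]urepK -[v]urepK -[w]urepK !upiE.
by apply/upiP; constructor.
Qed.
Fact uaddC : commutative uadd.
Proof.
by move=> u v; rewrite -[u]urepK -[v]urepK !upiE; apply/upiP; constructor.
Qed.
Fact uadd0 : left_id (upi UZero) uadd.
Proof. by move=> u; rewrite -[u]urepK !upiE; apply/upiP; constructor. Qed.
Fact uaddN : left_inverse (upi UZero) uopp uadd.
Proof.
by move=> u; rewrite -[u]urepK /uopp !upiE; apply/upiP; apply: ueqv_addN.
Qed.

HB.instance Definition _ := GRing.isZmodule.Build uea uaddA uaddC uadd0 uaddN.

Fact umulA : associative umul.
Proof.
move=> u v w; rewrite -[u]urepK -[v]urepK -[w]urepK !upiE.
by apply/upiP; constructor.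
Qed.
Fact umul1l : left_id (upi UOne) umul.
Proof. by move=> u; rewrite -[u]urepK !upiE; apply/upiP; constructor. Qed.
Fact umul1r : right_id (upi UOne) umul.
Proof. by move=> u; rewrite -[u]urepK !upiE; apply/upiP; constructor. Qed.
Fact umulDl : left_distributive umul +%R.
Proof.
move=> u v w; rewrite -[u]urepK -[v]urepK -[w]urepK /GRing.add /= !upiE.
by apply/upiP; constructor.
Qed.
Fact umulDr : right_distributive umul +%R.
Proof.
move=> u v w; rewrite -[u]urepK -[v]urepK -[w]urepK /GRing.add /= !upiE.
by apply/upiP; constructor.
Qed.
Fact uone_neq0 : upi UOne != 0.
Proof.
apply/eqP => /upiP h.
have triv : @urepr K L K^o (fun _ => 0).
  by split=> [c x y|a b x y]; rewrite ?mulr0 ?scaler0 ?subr0 ?addr0.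
by have /eqP := ueval_eqv triv h; rewrite /= oner_eq0.
Qed.

HB.instance Definition _ := GRing.Zmodule_isNzRing.Build uea
  umulA umul1l umul1r umulDl umulDr uone_neq0.

Fact uscaleA a b v : uscale a (uscale b v) = uscale (a * b) v.
Proof. by rewrite -[v]urepK !upiE; apply/upiP; constructor. Qed.
Fact uscale1 : left_id 1 uscale.
Proof. by move=> u; rewrite -[u]urepK !upiE; apply/upiP; constructor. Qed.
Fact uscaleDr : right_distributive uscale +%R.
Proof.
move=> c u v; rewrite -[u]urepK -[v]urepK /GRing.add /= !upiE.
by apply/upiP; constructor.
Qed.
Fact uscaleDl v : {morph uscale^~ v : a b / a + b}.
Proof.
move=> a b; rewrite -[v]urepK /= !upiE [RHS]/GRing.add /= !upiE.
by apply/upiP; constructor.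
Qed.

HB.instance Definition _ := GRing.Zmodule_isLmodule.Build K uea
  uscaleA uscale1 uscaleDr uscaleDl.

Fact uscaleAl (c : K) (u v : uea) : c *: (u * v) = (c *: u) * v.
Proof.
rewrite -[u]urepK -[v]urepK /GRing.scale /GRing.mul /= !upiE.
by apply/upiP; apply: ueqv_scaleAl.
Qed.
HB.instance Definition _ := GRing.Lmodule_isLalgebra.Build K uea uscaleAl.

Fact uscaleAr (c : K) (u v : uea) : c *: (u * v) = u * (c *: v).
Proof.
rewrite -[u]urepK -[v]urepK /GRing.scale /GRing.mul /= !upiE.
by apply/upiP; apply: ueqv_scaleAr.
Qed.
HB.instance Definition _ := GRing.Lalgebra_isAlgebra.Build K uea uscaleAr.

Definition uin (x : L) : uea := upi (UGen x).

Lemma uin_repr : urepr uin.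
Proof.
split=> [c x y|a b x y].
  rewrite {2}/uin /GRing.add /GRing.scale /= !upiE.
  by apply/upiP; exact: ueqv_gen.
rewrite -scaleNr /uin /GRing.add /GRing.scale /GRing.mul /= !upiE.
by apply/upiP; exact: ueqv_br.
Qed.

HB.instance Definition _ :=
  GRing.isLinear.Build K L uea *:%R uin uin_repr.1.

(* Only meaningful when f satisfies urepr.                                    *)
Definition ulift (A : algType K) (f : L -> A) (u : uea) : A := ueval f (urep u).

Section Lift.
Variables (A : algType K) (f : L -> A).
Hypothesis fP : urepr f.

Lemma ulift_upi t : ulift f (upi t) = ueval f t.
Proof. by apply: ueval_eqv => //; exact: urep_upi. Qed.

Lemma ulift_in x : ulift f (uin x) = f x.
Proof. exact: ulift_upi. Qed.

Lemma uliftP : [/\ linear (ulift f), ulift f 1 = 1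
  & {morph ulift f : u v / u * v}].
Proof.
split.
- move=> c u v; have := ulift_upi (UAdd (UScale c (urep u)) (urep v)).
  by rewrite -upi_add -upi_scale !urepK.
- exact: ulift_upi.
- move=> u v; have := ulift_upi (UMul (urep u) (urep v)).
  by rewrite -upi_mul !urepK.
Qed.

Lemma ulift_uniq (g : uea -> A) : linear g -> g 1 = 1 ->
  {morph g : u v / u * v} -> (forall x, g (uin x) = f x) -> g =1 ulift f.
Proof.
move=> glin g1 gM gf u; rewrite -[u]urepK ulift_upi.
have gD v w : g (v + w) = g v + g w.
  by have := glin 1 v w; rewrite !scale1r.
have g0 : g 0 = 0 by apply: (addrI (g 0)); rewrite -gD !addr0.
have gZ c v : g (c *: v) = c *: g v.
  by have := glin c v 0; rewrite !addr0 g0 addr0.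
elim: (urep u) => //= [s IHs t IHt|s IHs t IHt|c s IHs].
- by rewrite -upi_add gD IHs IHt.
- by rewrite -upi_mul gM IHs IHt.
- by rewrite -upi_scale gZ IHs.
Qed.

End Lift.

(* The parity automorphism: identity on the even part of U(L), minus the      *)
(* identity on its odd part.                                                  *)
Definition uparity : uea -> uea :=
  ulift (fun x => uin (hpart false x - hpart true x)).

(* The component of parity d of u in U(L).                                    *)
Definition upart (d : bool) (u : uea) : uea :=
  2^-1 *: (u + (-1) ^+ d *: uparity u).

(* [u, v] = u v - (-1)^(|u||v|) v u, extended bilinearly from the homogeneous *)
(* elements.                                                                  *)
Definition scomm (u v : uea) : uea :=
  \sum_(a : bool) \sum_(b : bool)
    (upart a u * upart b v - (-1) ^+ (a && b) *: (upart b v * upart a u)).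

Definition supercenter : set uea := [set z | forall x : L, scomm z (uin x) = 0].

Lemma uparity_repr : urepr (fun x => uin (hpart false x - hpart true x)).
Proof.
have hE d x : uin (hpart false (hpart d x) - hpart true (hpart d x))
    = (-1) ^+ d *: uin (hpart d x).
  by rewrite !hpart_proj; case: d; rewrite /= ?sub0r ?subr0 ?linearN ?scaleN1r
    ?scale1r.
split=> [c x y|a b x y].
  transitivity (uin (c *: (hpart false x - hpart true x)
                      + (hpart false y - hpart true y))).
    by congr uin; rewrite !linearP /= scalerBr scalerN addrACA -scalerN.
  exact: linearP.
rewrite -sbr_graded hE sbr_graded uin_repr.2 !hE.
rewrite -!(scalerAl, scalerAr) !scalerA signr_addb scalerBr scalerA.
congr (_ *: _ - _ *: _).
by case: a b => [] []; rewrite ?(mulrN1, mulr1, mul1r).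
Qed.

Fact uparity_is_linear : linear uparity.
Proof. by have [] := uliftP uparity_repr. Qed.
HB.instance Definition _ :=
  GRing.isLinear.Build K uea uea *:%R uparity uparity_is_linear.

Fact uparity_is_monoid_morphism : monoid_morphism uparity.
Proof. by have [_ p1 pM] := uliftP uparity_repr; split. Qed.
HB.instance Definition _ :=
  GRing.isMonoidMorphism.Build uea uea uparity uparity_is_monoid_morphism.

Lemma uparity_in d x : uparity (uin (hpart d x)) = (-1) ^+ d *: uin (hpart d x).
Proof.
rewrite /uparity (ulift_in uparity_repr) !hpart_proj.
by case: d; rewrite /= ?sub0r ?subr0 ?linearN ?scaleN1r ?scale1r.
Qed.

Lemma uparityK : involutive uparity.
Proof.
move=> u; transitivity (ulift uin u); last first.
  by apply/esym/(ulift_uniq uin_repr).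
apply: (ulift_uniq uin_repr (g := uparity \o uparity)) => [c v w||v w|x] /=.
- by rewrite !linearP.
- by rewrite !rmorph1.
- by rewrite !rmorphM.
rewrite -[x]hpart_sum linearD /= !linearD /= !uparity_in !linearZ /=.
by rewrite !uparity_in !scalerA -!expr2 !sqrr_sign !scale1r.
Qed.

Lemma upart_sum u : upart false u + upart true u = u.
Proof.
rewrite /upart -scalerDr /= expr0 expr1 scale1r scaleN1r addrACA subrr addr0.
by rewrite -[in LHS](scale1r u) -scalerDl scalerA mulVf ?scale1r // pnatr_eq0.
Qed.

Lemma upart_in d x : upart d (uin x) = uin (hpart d x).
Proof.
rewrite /upart -{1 2}[x]hpart_sum !linearD /= !uparity_in.
have half (v : uea) : 2^-1 *: (v + v) = v.
  by rewrite -mulr2n -scaler_nat scalerA mulVf ?scale1r ?pnatr_eq0.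
case: d; rewrite /= ?expr0 ?expr1 ?scale1r !scaleN1r.
  by rewrite -!scalerDr scaleN1r opprB addrC addrA subrK half.
by rewrite -!scalerDr addrACA subrr addr0 half.
Qed.

Lemma upartM d (u v : uea) :
  upart d (u * v) = \sum_(a : bool) upart a u * upart (a (+) d) v.
Proof.
have quarter (x y z t : uea) :
    (2^-1 *: (x - y)) * (2^-1 *: (z - t)) + (2^-1 *: (x + y)) * (2^-1 *: (z + t))
    = 2^-1 *: (x * z + y * t).
  have dbl (w : uea) : w + w = (2 : K) *: w by rewrite scaler_nat mulr2n.
  rewrite -!scalerAl -!scalerAr !scalerA -scalerDr mulrBl mulrDl addrACA.
  rewrite -mulrDr -mulrN opprB -mulrDr.
  rewrite [z - t + _]addrACA addNr addr0 dbl [t - z + _]addrA subrK.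
  by rewrite dbl -!scalerAr -scalerDr scalerA -mulrA mulVf ?mulr1 ?pnatr_eq0 //.
rewrite big_bool /upart addFb addTb rmorphM /=.
case: d; rewrite /= ?expr0 ?expr1 ?scale1r !scaleN1r; last by rewrite quarter.
by have := quarter u (uparity u) v (- uparity v); rewrite opprK mulrN => ->.
Qed.

Lemma scomm_in a b x y :
  scomm (uin (hpart a x)) (uin (hpart b y)) = uin (sbr (hpart a x) (hpart b y)).
Proof.
rewrite uin_repr.2 /scomm !big_bool /= !upart_in !hpart_proj.
by case: a b => [] []; rewrite /= !linear0 !(mul0r, mulr0, scaler0, subrr,
  addr0, add0r, oppr0).
Qed.

End UEA.

Arguments supercenter {K} L.

(* The algebra morphism U(L1) -> U(L2) induced by f : L1 -> L2, provided f    *)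
(* satisfies lsmorph.  When f is moreover injective, so is umap f, by the     *)
(* Poincare-Birkhoff-Witt theorem: this is the sense in which U(L1) is viewed *)
(* as a subalgebra of U(L2).                                                  *)
Definition umap (K : numFieldType) (L1 L2 : lieSuperType K) (f : L1 -> L2) :
  uea L1 -> uea L2 := ulift (fun x => uin (f x)).

Lemma umap_repr (K : numFieldType) (L1 L2 : lieSuperType K) (f : L1 -> L2) :
  lsmorph f -> urepr (fun x => uin (f x)).
Proof.
move=> [flin fpart fbr]; split=> [c x y|a b x y].
  by rewrite flin linearP.
by rewrite fbr !fpart (uin_repr L2).2.
Qed.

Lemma umapP (K : numFieldType) (L1 L2 : lieSuperType K) (f : L1 -> L2) :
  lsmorph f ->
  [/\ linear (umap f), umap f 1 = 1, {morph umap f : u v / u * v}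
    & forall x, umap f (uin x) = uin (f x)].
Proof.
by move=> /umap_repr fP; have [? ? ?] := uliftP fP; split=> // x; exact: ulift_in.
Qed.

(* The pair (A, B) stands for the block matrix X_{A,B}.                       *)
Definition q (K : numFieldType) (n : nat) : Type := ('M[K]_n * 'M[K]_n)%type.

Section Q.
Variables (K : numFieldType) (n : nat).

HB.instance Definition _ := GRing.Lmodule.on (q K n).

Definition qX (x : q K n) : 'M[K]_(n + n) := block_mx x.1 x.2 x.2 x.1.

Definition q_hpart (d : bool) (x : q K n) : q K n :=
  if d then (0, x.2) else (x.1, 0).

Definition q_sbr (x y : q K n) : q K n :=
  ((x.1 *m y.1 - y.1 *m x.1) + (x.2 *m y.2 + y.2 *m x.2),
   (x.1 *m y.2 - y.2 *m x.1) + (x.2 *m y.1 - y.1 *m x.2)).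

Lemma q_sbr00 (A A' : 'M[K]_n) :
  q_sbr (A, 0) (A', 0) = (A *m A' - A' *m A, 0).
Proof. by rewrite /q_sbr /= !(mulmx0, mul0mx, subrr, addr0). Qed.

Lemma q_sbr01 (A B : 'M[K]_n) : q_sbr (A, 0) (0, B) = (0, A *m B - B *m A).
Proof. by rewrite /q_sbr /= !(mulmx0, mul0mx, subrr, addr0). Qed.

Lemma q_sbr11 (B B' : 'M[K]_n) :
  q_sbr (0, B) (0, B') = (B *m B' + B' *m B, 0).
Proof. by rewrite /q_sbr /= !(mulmx0, mul0mx, subrr, addr0, add0r, oppr0). Qed.

(* The bracket is the supercommutator of block matrices.                      *)
Lemma qX_sbr a b x y :
  qX (q_sbr (q_hpart a x) (q_hpart b y))
  = qX (q_hpart a x) *m qX (q_hpart b y)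
    - (-1) ^+ (a && b) *: (qX (q_hpart b y) *m qX (q_hpart a x)).
Proof.
rewrite /qX !mulmx_block scale_block_mx opp_block_mx add_block_mx.
case: a b => [] []; rewrite /q_sbr /= !(mulmx0, mul0mx, subrr, addr0, add0r,
  sub0r, subr0, scaler0, scale1r, scaleN1r, oppr0, opprK) //.
Qed.

Lemma qX_inj : injective qX.
Proof. by move=> [A B] [A' B'] /eq_block_mx[/= -> -> _ _]. Qed.

Fact qX_linear : linear qX.
Proof. by move=> c x y; rewrite /qX scale_block_mx add_block_mx. Qed.

Fact q_hpart_linear d : linear (q_hpart d).
Proof.
by case: d => c x y; congr pair; rewrite /= ?scaler0 ?addr0.
Qed.
Fact q_hpart_proj a b x :
  q_hpart a (q_hpart b x) = if a == b then q_hpart a x else 0.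
Proof. by case: a b => [] []. Qed.
Fact q_hpart_sum x : q_hpart false x + q_hpart true x = x.
Proof. by case: x => A B; congr pair; rewrite /= ?addr0 ?add0r. Qed.

(* Reduces an identity between noncommutative matrix polynomials to an        *)
(* identity between linear combinations of monomials, checked entrywise.      *)
Local Ltac mxring :=
  rewrite ?(mulmx0, mul0mx, mulmxBl, mulmxBr, mulmxDl, mulmxDr, mulNmx,
    mulmxN) -?scalemxAl -?scalemxAr ?mulmxA;
  repeat match goal with |- context [@mulmx ?R ?m ?n ?p ?A ?B] =>
    move: (@mulmx R m n p A B) end;
  move=> *; apply/matrixP => i j; rewrite !mxE; ring.

Fact q_sbr_linearr x : linear (q_sbr x).
Proof. by move=> c y z; congr pair; rewrite /=; mxring. Qed.

Fact q_sbr_linearl y : linear (q_sbr^~ y).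
Proof. by move=> c x z; congr pair; rewrite /=; mxring. Qed.

Fact q_sbr_graded a b x y :
  q_hpart (a (+) b) (q_sbr (q_hpart a x) (q_hpart b y))
  = q_sbr (q_hpart a x) (q_hpart b y).
Proof.
by case: a b => [] []; rewrite /q_sbr /= !(mulmx0, mul0mx, subrr, addr0).
Qed.

Fact q_sbr_skew a b x y :
  q_sbr (q_hpart a x) (q_hpart b y)
    = - ((-1) ^+ (a && b) *: q_sbr (q_hpart b y) (q_hpart a x)).
Proof.
by case: a b => [] []; congr pair; rewrite /= ?expr1 ?expr0; mxring.
Qed.

Fact q_sbr_jacobi a b x y z :
  q_sbr (q_hpart a x) (q_sbr (q_hpart b y) z)
    = q_sbr (q_sbr (q_hpart a x) (q_hpart b y)) z
      + (-1) ^+ (a && b) *: q_sbr (q_hpart b y) (q_sbr (q_hpart a x) z).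
Proof.
by case: a b => [] []; congr pair; rewrite /= ?expr1 ?expr0; mxring.
Qed.

HB.instance Definition _ := Lmodule_isLieSuper.Build K (q K n)
  q_hpart_linear q_hpart_proj q_hpart_sum q_sbr_linearr q_sbr_linearl
  q_sbr_graded q_sbr_skew q_sbr_jacobi.

Definition sq_pred : {pred q K n} := [pred x | \tr x.2 == 0].

Fact sq_submod : submod_closed sq_pred.
Proof.
split=> [|c x y]; rewrite !inE /= ?mxtrace0 // mxtraceD mxtraceZ.
by move=> /eqP -> /eqP ->; rewrite mulr0 addr0.
Qed.

HB.instance Definition _ :=
  GRing.isSubmodClosed.Build K (q K n) sq_pred
    (GRing.submod_closed_semi sq_submod).

Record sq : Type := Sq { sq_val :> q K n; sq_valP : sq_val \in sq_pred }.

HB.instance Definition _ := [isSub for sq_val].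
HB.instance Definition _ := [Choice of sq by <:].
HB.instance Definition _ := [SubChoice_isSubLmodule of sq by <:].

Fact sq_hpart_subproof d (x : sq) : q_hpart d (sq_val x) \in sq_pred.
Proof.
by case: d; rewrite inE /= ?mxtrace0 //; exact: sq_valP x.
Qed.
Definition sq_hpart d (x : sq) : sq := Sq (sq_hpart_subproof d x).

Fact sq_sbr_subproof (x y : sq) : q_sbr (sq_val x) (sq_val y) \in sq_pred.
Proof.
rewrite inE /= mxtraceD !linearB /= ![\tr ((sq_val y).2 *m _)]mxtrace_mulC.
by rewrite ![\tr ((sq_val y).1 *m _)]mxtrace_mulC !subrr addr0.
Qed.
Definition sq_sbr (x y : sq) : sq := Sq (sq_sbr_subproof x y).

Fact sq_hpart_linear d : linear (sq_hpart d).
Proof. by move=> c x y; apply/val_inj; exact: q_hpart_linear. Qed.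
Fact sq_hpart_proj a b x :
  sq_hpart a (sq_hpart b x) = if a == b then sq_hpart a x else 0.
Proof.
by apply/val_inj; rewrite /= q_hpart_proj; case: ifP.
Qed.
Fact sq_hpart_sum x : sq_hpart false x + sq_hpart true x = x.
Proof. by apply/val_inj; exact: q_hpart_sum. Qed.
Fact sq_sbr_linearr x : linear (sq_sbr x).
Proof. by move=> c y z; apply/val_inj; exact: q_sbr_linearr. Qed.
Fact sq_sbr_linearl y : linear (sq_sbr^~ y).
Proof. by move=> c x z; apply/val_inj; exact: q_sbr_linearl. Qed.
Fact sq_sbr_graded a b x y :
  sq_hpart (a (+) b) (sq_sbr (sq_hpart a x) (sq_hpart b y))
  = sq_sbr (sq_hpart a x) (sq_hpart b y).
Proof. by apply/val_inj; exact: q_sbr_graded. Qed.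
Fact sq_sbr_skew a b x y :
  sq_sbr (sq_hpart a x) (sq_hpart b y)
    = - ((-1) ^+ (a && b) *: sq_sbr (sq_hpart b y) (sq_hpart a x)).
Proof. by apply/val_inj; exact: q_sbr_skew. Qed.
Fact sq_sbr_jacobi a b x y z :
  sq_sbr (sq_hpart a x) (sq_sbr (sq_hpart b y) z)
    = sq_sbr (sq_sbr (sq_hpart a x) (sq_hpart b y)) z
      + (-1) ^+ (a && b) *: sq_sbr (sq_hpart b y) (sq_sbr (sq_hpart a x) z).
Proof. by apply/val_inj; exact: q_sbr_jacobi. Qed.

HB.instance Definition _ := Lmodule_isLieSuper.Build K sq
  sq_hpart_linear sq_hpart_proj sq_hpart_sum sq_sbr_linearr sq_sbr_linearl
  sq_sbr_graded sq_sbr_skew sq_sbr_jacobi.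

Lemma sq_val_lsmorph : lsmorph sq_val.
Proof. by split. Qed.

(* The line K Id, with Id = X_{1,0}, in q(n) and in sq(n).                    *)
Definition q_scalar : {pred q K n} :=
  [pred x | `[< exists c : K, x = c *: (1%:M, 0)%R >]].
Definition sq_scalar : {pred sq} := [pred x | sq_val x \in q_scalar].

Fact q_scalar_submod : submod_closed q_scalar.
Proof.
split=> [|c x y /asboolP[a ->] /asboolP[b ->]]; apply/asboolP.
  by exists 0; rewrite scale0r.
by exists (c * a + b); rewrite scalerDl scalerA.
Qed.

Fact q_scalar_hpart d x : x \in q_scalar -> hpart d x \in q_scalar.
Proof.
move=> /asboolP[c ->]; rewrite linearZ; apply/asboolP.
by case: d; [exists 0|exists c]; rewrite ?scale0r // -[RHS](scaler0 _ c).
Qed.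

Fact q_scalar_sbr x y : y \in q_scalar -> sbr x y \in q_scalar.
Proof.
move=> /asboolP[c ->]; rewrite linearZ /=; apply/asboolP; exists 0.
rewrite scale0r; suff -> : sbr x ((1%:M, 0) : q K n) = 0 by rewrite scaler0.
by congr pair; rewrite /= !(mulmx1, mul1mx, mulmx0, mul0mx, subrr, addr0).
Qed.

Definition q_scalar_ideal : lieIdeal (q K n) :=
  LieIdeal q_scalar_submod q_scalar_hpart q_scalar_sbr.

Fact sq_scalar_submod : submod_closed sq_scalar.
Proof.
split=> [|c x y]; first exact: q_scalar_submod.1.
exact: q_scalar_submod.2.
Qed.
Fact sq_scalar_hpart d x : x \in sq_scalar -> hpart d x \in sq_scalar.
Proof. exact: q_scalar_hpart. Qed.
Fact sq_scalar_sbr x y : y \in sq_scalar -> sbr x y \in sq_scalar.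
Proof. exact: q_scalar_sbr. Qed.

Definition sq_scalar_ideal : lieIdeal sq :=
  LieIdeal sq_scalar_submod sq_scalar_hpart sq_scalar_sbr.

Definition pq : lieSuperType K := lquot q_scalar_ideal.
Definition psq : lieSuperType K := lquot sq_scalar_ideal.

(* psq(n) -> pq(n) induced by the inclusion of sq(n) in q(n).                 *)
Definition psq_incl (u : psq) : pq :=
  lpi q_scalar_ideal (sq_val (repr (u : lquot sq_scalar_ideal))).

Lemma psq_incl_lpi (x : sq) :
  psq_incl (lpi sq_scalar_ideal x) = lpi q_scalar_ideal (sq_val x).
Proof.
by apply/lpiP; exact: (repr_lpi sq_scalar_ideal).
Qed.

Lemma psq_incl_lsmorph : lsmorph psq_incl.
Proof.
have [sl sh sb] := lpi_lsmorph sq_scalar_ideal.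
have [ql qh qb] := lpi_lsmorph q_scalar_ideal.
split.
- move=> c u v; have [x ->] := lpi_surj u; have [y ->] := lpi_surj v.
  by rewrite -sl !psq_incl_lpi -ql.
- move=> d u; have [x ->] := lpi_surj u.
  by rewrite -sh !psq_incl_lpi -qh.
- move=> u v; have [x ->] := lpi_surj u; have [y ->] := lpi_surj v.
  by rewrite -sb !psq_incl_lpi -qb.
Qed.

Lemma psq_incl_inj : injective psq_incl.
Proof.
move=> u v; have [x ->] := lpi_surj u; have [y ->] := lpi_surj v.
by rewrite !psq_incl_lpi => /lpiP h; apply/lpiP.
Qed.

End Q.

(* Main.v *)
From HB Require Import structures.
Require Import Defs.
From mathcomp Require Import all_boot all_order all_algebra.
From mathcomp Require Import boolp classical_sets functions reals complex.
From mathcomp Require Import ring.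

(** Both statements are instances of a theorem on a Lie superalgebra L with an
    ideal M of codimension 1 and odd quotient (supercenter_hyperplane): if
    neither U(L) nor U(M) has a nonzero odd supercentral element, the two
    supercentres coincide. Indeed, choose an odd H outside M; then
    U(L) = U(M) + U(M) H is free with basis 1, H. If z = a + b H is supercentral
    in U(L), it is even, so b is odd, and comparing coefficients of H in
    [x, z] = 0 for x in M shows that b is supercentral in U(M); hence b = 0 and
    z = a. Conversely, if a is supercentral in U(M), then so is [H, a], which is
    odd; hence [H, a] = 0.

    There are no odd supercentral elements if l [y, x] is a nondegenerate
    form on the odd part for some linear form l on L (odd_supercentral_eq0).
    Heuristically, U(L) degenerates to the Clifford algebra of this form at the
    point l, and the supercentre of a nondegenerate Clifford algebra consists of
    the scalars. The proof works with the leading part of z in the symmetric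
    algebra of L, expanded around l. The lowest terms, first in the number of odd
    variables and then in the distance to l, are subject only to the contraction
    of an odd variable with l [y, _]; as l [y, _] is an arbitrary odd linear form,
    they vanish, and induction clears the remaining ones (odd_central_contrs).

    This requires partial derivatives on the graded algebra of U(L), which the
    Poincare-Birkhoff-Witt theorem would provide. They are obtained from the
    coproduct: a linear form f on U(L) gives the contraction
    u |-> (f (x) id)(Delta u), these operators supercommute (contrC) and transform
    by the coadjoint action (contr_sad), and if f vanishes at 1 they lower the
    length of words. Euler's identity (eulerP) recovers the leading part of an
    element from its derivatives. All that is needed of L is that its coordinates
    extend to linear forms on U(L) vanishing at 1, which a suitable
    representation ensures: left multiplication for q(n), and the adjoint
    representation on q(n) for pq(n). The same contractions prove that U(M)
    embeds into U(L) (umap_inj_framing) and that 1, H is a basis (umap_free).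

    For q(n) and its ideal sq(n) take l(A, B) = tr (D A) with D diagonal, so that
    the form on the odd part is tr ((D B + B D) B'). It is nondegenerate on q(n)
    if d_i + d_j <> 0 for all i, j, and on sq(n) if moreover the trace of the
    inverse of D is nonzero: D = 1 will do. For pq(n) and psq(n) the trace of D
    has to vanish as well, and such a D exists as soon as n >= 3. *)

Set Implicit Arguments.
Unset Strict Implicit.
Unset Printing Implicit Defensive.

Import Order.TTheory GRing.Theory Num.Theory.

Local Open Scope ring_scope.

Ltac pull_front t :=
  repeat match goal with
  | |- ?a + (t + ?b) = _ => rewrite [LHS](addrCA a t b)
  | |- context [?a + (t + ?b)] => rewrite (addrCA a t b)
  | |- context [?a + t] => rewrite (addrC a t)
  end.

(** Decides an identity between signed sums in a commutative group, by
    cancelling opposite terms pairwise. *)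
Ltac abel :=
  apply/eqP; rewrite -subr_eq0; apply/eqP; rewrite ?(opprD, opprK, oppr0);
  rewrite -?addrA ?(add0r, addr0);
  repeat match goal with
  | |- - ?t + _ = 0 =>
    first [rewrite addNr
          | match goal with |- context [?t' + _] =>
              unify t t'; pull_front t'; rewrite ?addNKr end]
  | |- ?t + _ = 0 =>
    match goal with |- context [@GRing.opp ?S ?t'] =>
      unify t t'; pull_front (@GRing.opp S t'); rewrite ?(addKr, addNr) end
  end; try reflexivity.

(** * Modules over the enveloping algebra *)

Section ModuleLift.
Variables (K : numFieldType) (L : lieSuperType K) (V : lmodType K).
Variables (P : V -> Prop) (act : L -> V -> V).

(** A representation of L on the subspace of V cut out by P: carrying the
    subspace as a predicate allows V to be a space of all functions and P to
    single out the linear ones, on which alone the bracket relation holds. *)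
Record lie_action : Prop := LieAction {
  lact_comb : forall c v w, P v -> P w -> P (c *: v + w);
  lact_stable : forall x v, P v -> P (act x v);
  lact_linr : forall x c v w, P v -> P w ->
    act x (c *: v + w) = c *: act x v + act x w;
  lact_linl : forall v c x y, P v ->
    act (c *: x + y) v = c *: act x v + act y v;
  lact_br : forall a b x y v, P v ->
    act (sbr (hpart a x) (hpart b y)) v
    = act (hpart a x) (act (hpart b y) v)
      - (-1) ^+ (a && b) *: act (hpart b y) (act (hpart a x) v)
}.

Fixpoint tact (t : uterm L) (v : V) : V :=
  match t with
  | UGen x => act x v
  | UZero => 0
  | UOne => v
  | UAdd s t => tact s v + tact t v
  | UMul s t => tact s (tact t v)
  | UScale c s => c *: tact s v
  end.

Definition mact (u : uea L) : V -> V := tact (urep u).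

Hypothesis actP : lie_action.

Lemma lact_0 v : P v -> P 0.
Proof. by move=> Pv; have := lact_comb actP (-1) Pv Pv; rewrite scaleN1r addNr. Qed.

Lemma lact_D v w : P v -> P w -> P (v + w).
Proof. by move=> Pv /(lact_comb actP 1 Pv); rewrite scale1r. Qed.

Lemma lact_Z c v : P v -> P (c *: v).
Proof.
by move=> Pv; have := lact_comb actP c Pv (lact_0 Pv); rewrite addr0.
Qed.

Lemma tact_stable t v : P v -> P (tact t v).
Proof.
elim: t v => [x|||s IHs t IHt|s IHs t IHt|c s IHs] v Pv //=.
- exact: lact_stable actP _ _ Pv.
- exact: lact_0 Pv.
- exact: lact_D (IHs _ Pv) (IHt _ Pv).
- exact/IHs/IHt.
- exact/lact_Z/IHs.
Qed.

Lemma tact_linr t c v w : P v -> P w ->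
  tact t (c *: v + w) = c *: tact t v + tact t w.
Proof.
elim: t c v w => [x|||s IHs t IHt|s IHs t IHt|d s IHs] c v w Pv Pw //=.
- exact: lact_linr.
- by rewrite scaler0 addr0.
- by rewrite IHs // IHt // scalerDr addrACA.
- by rewrite IHt // IHs //; exact: tact_stable.
- by rewrite IHs // scalerDr !scalerA mulrC.
Qed.

Lemma tact_eqv s t v : P v -> ueqv s t -> tact s v = tact t v.
Proof.
move=> Pv st; elim: st v Pv => {s t} //=.
- by move=> s t _ IH v Pv; rewrite IH.
- by move=> s t r _ IH1 _ IH2 v Pv; rewrite IH1 // IH2.
- by move=> s s' t t' _ IH1 _ IH2 v Pv; rewrite IH1 // IH2.
- move=> s s' t t' _ IH1 _ IH2 v Pv; rewrite IH2 // IH1 //.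
  exact: tact_stable.
- by move=> c s s' _ IH v Pv; rewrite IH.
- by move=> s t r v Pv; rewrite addrA.
- by move=> s t v Pv; rewrite addrC.
- by move=> s v Pv; rewrite add0r.
- by move=> s v Pv; rewrite scaleN1r addNr.
- move=> s t r v Pv.
  have := @tact_linr s 1 _ _ (tact_stable t Pv) (tact_stable r Pv).
  by rewrite !scale1r.
- by move=> a b s v Pv; rewrite scalerA.
- by move=> s v Pv; rewrite scale1r.
- by move=> c s t v Pv; rewrite scalerDr.
- by move=> a b s v Pv; rewrite scalerDl.
- move=> c s t v Pv; have Pt := tact_stable t Pv.
  have := @tact_linr s c _ _ Pt (lact_0 Pt); rewrite addr0 => ->.
  have := @tact_linr s (-1) _ _ Pt Pt.
  by rewrite !scaleN1r !addNr => ->; rewrite addr0.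
- by move=> c x y v Pv; rewrite lact_linl.
- by move=> a b x y v Pv; rewrite lact_br // scaleNr.
Qed.

Lemma mact_upi t v : P v -> mact (upi t) v = tact t v.
Proof. by move=> Pv; apply: tact_eqv => //; exact: urep_upi. Qed.

Lemma mact_stable u v : P v -> P (mact u v).
Proof. exact: tact_stable. Qed.

Lemma mact_linl c u w v : P v ->
  mact (c *: u + w) v = c *: mact u v + mact w v.
Proof.
move=> Pv; have := mact_upi (UAdd (UScale c (urep u)) (urep w)) Pv.
by rewrite -upi_add -upi_scale !urepK.
Qed.

Lemma mact1 v : P v -> mact 1 v = v.
Proof. exact: mact_upi. Qed.

Lemma mactM u w v : P v -> mact (u * w) v = mact u (mact w v).
Proof.
move=> Pv; have := mact_upi (UMul (urep u) (urep w)) Pv.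
by rewrite -upi_mul !urepK.
Qed.

Lemma mact_in x v : P v -> mact (uin x) v = act x v.
Proof. exact: mact_upi. Qed.

End ModuleLift.

(** * Parity and the super adjoint action *)

Section Super.
Variables (K : numFieldType) (L : lieSuperType K).
Local Notation U := (uea L).
Implicit Types (u v w : U) (x y : L).

Definition hom d x := hpart d x = x.

Lemma hom_hpart d x : hom d (hpart d x).
Proof. by rewrite /hom hpart_proj eqxx. Qed.

Lemma hom_other e d x : hom d x -> hpart e x = if e == d then x else 0.
Proof. by move=> hx; rewrite -{1}hx hpart_proj; case: eqP => // ->. Qed.

Lemma hom_sbr a b x y : hom a x -> hom b y -> hom (a (+) b) (sbr x y).
Proof. by rewrite /hom => <- <-; rewrite sbr_graded. Qed.

Lemma uin_sbr a b x y : hom a x -> hom b y ->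
  uin (sbr x y) = uin x * uin y - (-1) ^+ (a && b) *: (uin y * uin x).
Proof. by move=> <- <-; rewrite (uin_repr L).2. Qed.

Lemma uea_ind (Q : U -> Prop) :
  (forall c u v, Q u -> Q v -> Q (c *: u + v)) -> Q 1 ->
  (forall d x u, hom d x -> Q u -> Q (uin x * u)) -> forall u, Q u.
Proof.
move=> Qlin Q1 Qm u; rewrite -[u]mulr1.
have Q0 : Q 0 by have := Qlin (-1) _ _ Q1 Q1; rewrite scaleN1r addNr.
have QD v w : Q v -> Q w -> Q (v + w) by move=> /Qlin h /(h 1); rewrite scale1r.
have QZ c v : Q v -> Q (c *: v) by move=> /(Qlin c) /(_ Q0); rewrite addr0.
rewrite -[u]urepK; elim: (urep u) (1 : U) Q1 => {u}
  [x|||s IHs t IHt|s IHs t IHt|c s IHs] v Qv.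
- rewrite -[UGen x]/(UGen x) -/(uin x) -[x]hpart_sum linearD mulrDl.
  by apply: QD; apply: Qm Qv; exact: hom_hpart.
- by rewrite -[upi UZero]/(0 : U) mul0r.
- by rewrite -[upi UOne]/(1 : U) mul1r.
- by rewrite -upi_add -[uadd _ _]/(upi s + upi t) mulrDl; apply: QD; auto.
- by rewrite -upi_mul -[umul _ _]/(upi s * upi t) -mulrA; auto.
- by rewrite -upi_scale -[uscale _ _]/(c *: upi s) -scalerAl; auto.
Qed.

(** On elements of parity e this is the sign (-1)^(de): signs that depend on
    the parity of an arbitrary element are produced by the automorphism, so
    that identities need not be restricted to homogeneous elements. *)
Definition upar (d : bool) u : U := if d then uparity u else u.

Fact upar_is_linear d : linear (upar d).
Proof. by case: d => c u v //=; rewrite linearP. Qed.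
HB.instance Definition _ d :=
  GRing.isLinear.Build K U U *:%R (upar d) (upar_is_linear d).

Fact upar_is_monoid_morphism d : monoid_morphism (upar d).
Proof. by case: d; split=> [|u v]; rewrite /= ?rmorph1 ?rmorphM. Qed.
HB.instance Definition _ d :=
  GRing.isMonoidMorphism.Build U U (upar d) (upar_is_monoid_morphism d).

Lemma upar_in a d x : hom d x -> upar a (uin x) = (-1) ^+ (a && d) *: uin x.
Proof. by move=> <-; case: a => /=; rewrite ?uparity_in ?expr0 ?scale1r. Qed.

Lemma upar_upar a b u : upar a (upar b u) = upar (a (+) b) u.
Proof. by case: a b => [] [] //=; rewrite uparityK. Qed.

Lemma uparC a b u : upar a (upar b u) = upar b (upar a u).
Proof. by rewrite !upar_upar addbC. Qed.

(** The superderivation [y, _] of the enveloping algebra, for y of parity b.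
    Having y on the left lets it be computed letter by letter from the left end
    of a word, like the contractions below with which it has to be commuted. *)
Definition sad (b : bool) y u := uin y * u - upar b u * uin y.

Fact sad_is_linear b y : linear (sad b y).
Proof.
move=> c u v; rewrite /sad linearP /= mulrDr mulrDl -scalerAl -scalerAr.
by rewrite scalerBr opprD addrACA.
Qed.
HB.instance Definition _ b y :=
  GRing.isLinear.Build K U U *:%R (sad b y) (sad_is_linear b y).

Lemma sad1 b y : sad b y 1 = 0.
Proof. by rewrite /sad rmorph1 mulr1 mul1r subrr. Qed.

Lemma sad_inM a b x y u : hom a x -> hom b y ->
  sad b y (uin x * u) = uin (sbr y x) * u + (-1) ^+ (a && b) *: (uin x * sad b y u).
Proof.
move=> hx hy; rewrite (uin_sbr hy hx) /sad rmorphM /= (upar_in _ hx) andbC.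
by rewrite mulrBl mulrBr scalerBr -!scalerAl !mulrA addrA subrK.
Qed.

Lemma sad_in a b x y : hom a x -> hom b y -> sad b y (uin x) = uin (sbr y x).
Proof.
by move=> hx hy; rewrite -[uin x]mulr1 (sad_inM _ hx hy) sad1 mulr0 scaler0 addr0 mulr1.
Qed.

Lemma upar_sad a b y u : hom b y ->
  upar a (sad b y u) = (-1) ^+ (a && b) *: sad b y (upar a u).
Proof.
move=> hy; rewrite /sad linearB /= !rmorphM /= (upar_in _ hy) uparC.
by rewrite -scalerAl -scalerAr -scalerBr.
Qed.

Lemma uparity_upart d u : uparity (upart d u) = (-1) ^+ d *: upart d u.
Proof.
rewrite /upart linearZ linearD linearZ /= uparityK scalerA mulrC -scalerA.
congr (_ *: _); rewrite scalerDr scalerA -expr2 sqrr_sign scale1r addrC.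
by [].
Qed.

(** For y of parity b, the elements [z, y] and [y, z] differ by a sign and by
    the automorphism upar b. *)
Lemma supercenterP z :
  supercenter L z <-> forall b y, hom b y -> sad b y z = 0.
Proof.
have zE b : upar b z = upart false z + (-1) ^+ b *: upart true z.
  case: b; last by rewrite expr0 scale1r upart_sum.
  by rewrite /= -{1}[z]upart_sum linearD /= !uparity_upart expr0 scale1r.
have scommE y : scomm z (uin y)
    = \sum_(b : bool) (z * uin (hpart b y) - uin (hpart b y) * upar b z).
  rewrite /scomm exchange_big; apply: eq_bigr => b _.
  rewrite big_bool /= expr0 scale1r upart_in zE -{5}[z]upart_sum.
  rewrite mulrDl mulrDr -(scalerAr ((-1) ^+ b)) opprD [RHS]addrACA [RHS]addrC.
  by [].
have sadE b y : hom b y ->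
    sad b y z = - ((-1) ^+ b *: upar b (z * uin y - uin y * upar b z)).
  move=> hy; rewrite linearB /= !rmorphM /= (upar_in _ hy) andbb.
  rewrite upar_upar addbb /= -scalerAr -scalerAl -scalerBr scalerA -expr2.
  by rewrite sqrr_sign scale1r opprB.
split=> [Zz b y hy|Zz y].
  rewrite (sadE b y hy); have := Zz y; rewrite scommE -hy big_bool !hpart_proj.
  by case: b {hy} => /=; rewrite ?(linear0, mulr0, mul0r, subr0, addr0, add0r)
    => ->; rewrite ?(linear0, scaler0, oppr0).
rewrite scommE big1 // => b _; have hy := hom_hpart b y.
have := sadE b _ hy; rewrite Zz // => /esym/eqP.
rewrite oppr_eq0 scaler_eq0 signr_eq0 /= => /eqP /(congr1 (upar b)).
by rewrite upar_upar addbb linear0.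
Qed.

End Super.

(** * Contraction of the enveloping algebra by linear forms *)

Section Contraction.
Variables (K : numFieldType) (L : lieSuperType K).
Local Notation U := (uea L).
Implicit Types (u v w : U) (x y : L).

Record uform := Form {
  fval :> U -> K;
  form_lin : forall c u v, fval (c *: u + v) = c * fval u + fval v
}.
Implicit Types f g h : uform.

Lemma formD f u v : f (u + v) = f u + f v.
Proof. by have := form_lin f 1 u v; rewrite scale1r mul1r. Qed.

Lemma form0 f : f 0 = 0.
Proof. by apply: (addrI (f 0)); rewrite -formD !addr0. Qed.

Lemma formZ f c u : f (c *: u) = c * f u.
Proof. by have := form_lin f c u 0; rewrite form0 !addr0. Qed.

Fact fcomp_lin (p : {linear U -> U}) f c u v :
  f (p (c *: u + v)) = c * f (p u) + f (p v).
Proof. by rewrite linearP form_lin. Qed.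
Definition fcomp p f := Form (fcomp_lin p f).

Fact fcomb_lin c f g d u v :
  c * f (d *: u + v) + g (d *: u + v) = d * (c * f u + g u) + (c * f v + g v).
Proof. by rewrite !form_lin; ring. Qed.
Definition fcomb c f g := Form (fcomb_lin c f g).

Fact zero_repr : @urepr K L K^o (fun _ => 0).
Proof. by split=> [c x y|a b x y]; rewrite ?mulr0 ?scaler0 ?subr0 ?addr0. Qed.

(** The form is sealed behind an existence statement, so that simplification
    does not unfold it. *)
Fact counit_exists : {f : uform | f 1 = 1 & forall x u, f (uin x * u) = 0}.
Proof.
have [l u1 m] := uliftP zero_repr.
exists (@Form (ulift (fun _ : L => 0 : K^o)) l) => //= x u.
by rewrite m (ulift_in zero_repr) mul0r.
Qed.
Definition counit : uform := s2val counit_exists.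

Lemma counit1 : counit 1 = 1.
Proof. exact: (s2valP counit_exists). Qed.

Lemma counit_inM x u : counit (uin x * u) = 0.
Proof. exact: (s2valP' counit_exists). Qed.

Definition lmul x u := uin x * u.

Fact lmul_is_linear x : linear (lmul x).
Proof. by move=> c u v; rewrite /lmul mulrDr scalerAr. Qed.
HB.instance Definition _ x :=
  GRing.isLinear.Build K U U *:%R (lmul x) (lmul_is_linear x).

Local Notation shift x := (fcomp (lmul x)).
Local Notation fpar d := (fcomp (upar d)).

Definition flinear (C : uform -> U) :=
  forall c f g h, (forall u, h u = c * f u + g u) -> C h = c *: C f + C g.

Lemma flinear_ext C f g : flinear C -> f =1 g -> C f = C g.
Proof.
move=> PC fg; have := PC 0 f f g.
by rewrite scale0r add0r => <- // u; rewrite mul0r add0r fg.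
Qed.

Lemma flinear_Z C c f g : flinear C -> (forall u, g u = c * f u) -> C g = c *: C f.
Proof.
move=> PC gf; rewrite (PC (c - 1) f f g); first by rewrite scalerBl scale1r subrK.
by move=> u; rewrite gf; ring.
Qed.

(** The coproduct Delta of U is encoded by the map C : f |-> (f (x) id)(Delta u)
    that it induces on linear forms, which avoids tensor products. As
    Delta (x u) = (x (x) 1 + 1 (x) x) Delta u, passing from u to x u changes C
    into cact x C; the parity automorphism in the second summand is the sign
    of the exchange of x with the left factor of Delta u. *)
Definition cact x (C : uform -> U) : uform -> U := fun f =>
  C (shift x f) + (uin (hpart false x) * C (fpar false f)
                   + uin (hpart true x) * C (fpar true f)).

Lemma cact_hom d x C f : hom d x ->
  cact x C f = C (shift x f) + uin x * C (fpar d f).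
Proof.
move=> hx; rewrite /cact !(hom_other _ hx).
by case: d hx => /= _; rewrite linear0 mul0r ?addr0 ?add0r.
Qed.

Lemma add3ACA (V : zmodType) (a a' b b' c c' : V) :
  (a + a') + ((b + b') + (c + c')) = (a + (b + c)) + (a' + (b' + c')).
Proof. by rewrite [b + b' + _]addrACA [LHS]addrACA. Qed.

(** Both factors of U (x) U carry the relations of U, and the mixed terms
    cancel in the supercommutator: this is the multiplicativity of Delta. *)
Fact cactP : lie_action flinear cact.
Proof.
split.
- move=> c C D PC PD e f g h hE.
  rewrite !fctE (PC _ _ _ _ hE) (PD _ _ _ _ hE) !scalerDr !scalerA mulrC.
  by rewrite addrACA.
- move=> x C PC c f g h hE; rewrite /cact.
  have hp d : C (fpar d h) = c *: C (fpar d f) + C (fpar d g).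
    by apply: PC => u /=; rewrite hE.
  rewrite !hp (PC c (shift x f) (shift x g)); last by move=> u /=; rewrite hE.
  by rewrite !mulrDr -!scalerAr !scalerDr add3ACA.
- move=> x c C D PC PD; apply/funext => f; rewrite /cact !fctE.
  by rewrite !mulrDr -!scalerAr !scalerDr add3ACA.
- move=> C c x y PC; apply/funext => f; rewrite /cact !fctE.
  rewrite (PC c (shift x f) (shift y f)); last first.
    by move=> u /=; rewrite /lmul linearP mulrDl -scalerAl form_lin.
  by rewrite !linearP /= !mulrDl -!scalerAl !scalerDr add3ACA.
move=> a b x y C PC; move: (hpart a x) (hpart b y) (hom_hpart a x) (hom_hpart b y).
move=> {}x {}y hx hy; apply/funext => f; rewrite !fctE.
rewrite (cact_hom _ _ (hom_sbr hx hy)) !(cact_hom _ _ hx, cact_hom _ _ hy).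
set s := (-1) ^+ (a && b).
rewrite (PC (- s) (shift x (shift y f)) (shift y (shift x f))); last first.
  move=> u /=; rewrite /lmul (uin_sbr hx hy) mulrBl -scalerAl -scaleNr formD formZ.
  by rewrite !mulrA addrC.
have ss : s * s = 1 by rewrite -expr2 sqrr_sign.
have -> : C (fpar b (shift x f)) = s *: C (shift x (fpar b f)).
  apply: flinear_Z => // u /=; rewrite /lmul rmorphM /= (upar_in _ hx) -scalerAl.
  by rewrite formZ mulrA andbC ss mul1r.
have -> : C (fpar a (shift y f)) = s *: C (shift y (fpar a f)).
  apply: flinear_Z => // u /=; rewrite /lmul rmorphM /= (upar_in _ hy) -scalerAl.
  by rewrite formZ mulrA ss mul1r.
have -> : C (fpar b (fpar a f)) = C (fpar (a (+) b) f).
  by apply: flinear_ext => // u /=; rewrite upar_upar.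
have -> : C (fpar a (fpar b f)) = C (fpar (a (+) b) f).
  by apply: flinear_ext => // u /=; rewrite upar_upar addbC.
rewrite (uin_sbr hx hy) -/s mulrBl !mulrDr !scalerDr -!scalerAr !scalerA ss scale1r.
rewrite !opprD scaleNr -!scalerAl !mulrA.
move: (C _) (C _) (uin x * C _) => P2 P1 xE.
move: (_ * C _) (_ * C _) (_ * C _) => xyW yxW yB.
by abel.
Qed.

Definition eval1 f : U := (f 1)%:A.

Fact eval1_flinear : flinear eval1.
Proof. by move=> c f g h hE; rewrite /eval1 hE scalerDl scalerA. Qed.

(** Contraction of the left factor of the coproduct: (f (x) id)(Delta u). When
    f vanishes at 1 its leading part is the superderivation of the symmetric
    algebra along the restriction of f to L; these partial derivatives stand
    in for the Poincare-Birkhoff-Witt theorem. *)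
Definition contr f u : U := mact cact u eval1 f.

Lemma contr_flinear u : flinear (contr^~ u).
Proof. exact: (mact_stable cactP _ eval1_flinear). Qed.

Fact contr_is_linear f : linear (contr f).
Proof. by move=> c u v; rewrite /contr (mact_linl cactP _ _ _ eval1_flinear). Qed.
HB.instance Definition _ f :=
  GRing.isLinear.Build K U U *:%R (contr f) (contr_is_linear f).

Lemma contr_ext f g u : f =1 g -> contr f u = contr g u.
Proof. exact: (flinear_ext (contr_flinear u)). Qed.

Lemma contr_fZ c f g u : (forall v, g v = c * f v) -> contr g u = c *: contr f u.
Proof. exact: (flinear_Z (contr_flinear u)). Qed.

Lemma contr1 f : contr f 1 = (f 1)%:A.
Proof. by rewrite /contr (mact1 cactP eval1_flinear). Qed.

Lemma contr_inM d x f u : hom d x ->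
  contr f (uin x * u) = contr (shift x f) u + uin x * contr (fpar d f) u.
Proof.
move=> hx; rewrite /contr (mactM cactP _ _ eval1_flinear).
rewrite (mact_in cactP); last exact: (mact_stable cactP _ eval1_flinear).
exact: cact_hom.
Qed.

Lemma contr_counit u : contr counit u = u.
Proof.
elim/uea_ind: u => [c u v hu hv||d x u hx IH].
- by rewrite linearP /= hu hv.
- by rewrite contr1 counit1 scale1r.
rewrite (contr_inM _ _ hx) (@contr_fZ 0 counit); last first.
  by move=> v; rewrite /= /lmul counit_inM mul0r.
rewrite scale0r add0r (@contr_ext _ counit) ?IH // => v /=.
case: d {hx} => //=; elim/uea_ind: v => [c v w hv hw||d y v hy _].
- by rewrite linearP !form_lin hv hw.
- by rewrite rmorph1.
rewrite rmorphM /= -[uparity (uin y)]/(upar true _) (upar_in _ hy) -scalerAl formZ.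
by rewrite !counit_inM mulr0.
Qed.

Definition fhom (d : bool) f := forall u, f (uparity u) = (-1) ^+ d * f u.

Lemma fhom_upar d a f u : fhom d f -> f (upar a u) = (-1) ^+ (a && d) * f u.
Proof. by case: a => //= _; rewrite expr0 mul1r. Qed.

Lemma contr_par d a f u : fhom d f ->
  contr (fpar a f) u = (-1) ^+ (a && d) *: contr f u.
Proof. by move=> hf; apply: contr_fZ => v /=; exact: fhom_upar. Qed.

Lemma shift_par a b x f u : hom b x ->
  contr (fpar a (shift x f)) u = (-1) ^+ (a && b) *: contr (shift x (fpar a f)) u.
Proof.
move=> hx; apply: contr_fZ => v /=.
rewrite /lmul rmorphM /= (upar_in _ hx) -scalerAl formZ mulrA -expr2.
by rewrite sqrr_sign mul1r.
Qed.

Lemma fhom_shift a d x f : hom a x -> fhom d f -> fhom (d (+) a) (shift x f).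
Proof.
move=> hx hf u; rewrite /= /lmul.
have -> : uin x * uparity u = (-1) ^+ a *: uparity (uin x * u).
  rewrite rmorphM /= -[uparity (uin x)]/(upar true _) (upar_in _ hx) -scalerAl.
  by rewrite scalerA -expr2 sqrr_sign scale1r.
by rewrite formZ hf mulrA -signr_addb addbC.
Qed.

Lemma upar_contr a f u : upar a (contr f u) = contr (fpar a f) (upar a u).
Proof.
elim/uea_ind: u f => [c u v hu hv||b x u hx IH] f.
- by rewrite !linearP /= hu hv.
- by rewrite rmorph1 !contr1 /= rmorph1 linearZ /= rmorph1.
rewrite (contr_inM _ _ hx) linearD /= !rmorphM /= (upar_in _ hx) !IH.
rewrite -!scalerAl linearZ /= (contr_inM _ _ hx) scalerDr -(shift_par _ _ _ hx).
congr (_ + _ *: (_ * _)); apply: contr_ext => v /=.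
by rewrite uparC.
Qed.

Lemma fhom_odd1 f : fhom true f -> f 1 = 0.
Proof.
move=> hf; have := hf 1; rewrite rmorph1 expr1 mulN1r => /eqP.
by rewrite -subr_eq0 opprK -mulr2n mulrn_eq0 => /eqP.
Qed.

(** Partial derivatives supercommute, even before passing to leading parts,
    because the coproduct is supercocommutative: exchanging f and g in the
    formula for a word x u only permutes its terms. *)
Lemma contrC d e f g u : fhom d f -> fhom e g ->
  contr f (contr g u) = (-1) ^+ (d && e) *: contr g (contr f u).
Proof.
elim/uea_ind: u d e f g => [c u v hu hv||a x u hx IH] d e f g hf hg.
- by rewrite !linearP /= (hu d e) // (hv d e) // scalerDr !scalerA mulrC.
- rewrite !contr1 !linearZ /= !contr1 !scalerA.
  case: d hf => hf; first by rewrite (fhom_odd1 hf) !(mulr0, mul0r).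
  by rewrite expr0 mulr1 mulrC.
rewrite !(contr_inM _ _ hx) !(contr_par _ _ hf) !(contr_par _ _ hg) !linearD /=.
rewrite -!scalerAr !linearZ /= !(contr_inM _ _ hx) !(contr_par _ _ hf).
rewrite !(contr_par _ _ hg) -!scalerAr !scalerDr !scalerA.
rewrite (IH d (e (+) a) f (shift x g) hf (fhom_shift hx hg)).
rewrite (IH (d (+) a) e (shift x f) g (fhom_shift hx hf) hg).
rewrite (IH d e f g hf hg) -scalerAr !scalerA addrCA.
by case: a d e {hx hf hg IH} => [] [] [];
  rewrite /= ?expr0 ?expr1 ?(mulr1, mul1r, mulrN1, opprK).
Qed.

Lemma fhom_sad b d y f : hom b y -> fhom d f -> fhom (d (+) b) (fcomp (sad b y) f).
Proof.
move=> hy hf u /=.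
have -> : sad b y (uparity u) = (-1) ^+ b *: uparity (sad b y u).
  rewrite -[uparity (sad _ _ _)]/(upar true _) (upar_sad _ _ hy) scalerA /=.
  by rewrite -expr2 sqrr_sign scale1r.
by rewrite formZ hf mulrA -signr_addb addbC.
Qed.

(** The coproduct is equivariant for the adjoint action, so the commutator of
    the contraction by f with [y, _] is the contraction by the coadjoint image
    of f. *)
Lemma contr_sad b y f u : hom b y ->
  contr f (sad b y u) = contr (fcomp (sad b y) f) u + sad b y (contr (fpar b f) u).
Proof.
move=> hy; elim/uea_ind: u f => [c u v hu hv||a x u hx IH] f.
- by rewrite !linearP /= hu hv scalerDr addrACA.
- by rewrite sad1 linear0 !contr1 linearZ /= !sad1 scaler0 form0 scale0r addr0.
have hyx := hom_sbr hy hx.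
rewrite (sad_inM _ hx hy) linearD linearZ /= (contr_inM _ _ hyx) !(contr_inM _ _ hx).
rewrite !IH [sad b y (_ + _)]linearD /= (sad_inM _ hx hy).
rewrite (shift_par b _ _ hx) [b && a]andbC.
have -> : contr (shift x (fcomp (sad b y) f)) u
    = (-1) ^+ (a && b) *: contr (fcomp (sad b y) (shift x f)) u
      + contr (shift (sbr y x) f) u.
  apply: (contr_flinear u) => v /=; rewrite /lmul (sad_inM _ hx hy) formD formZ.
  by rewrite addrC.
have -> : contr (fpar a (fcomp (sad b y) f)) u
    = (-1) ^+ (a && b) *: contr (fcomp (sad b y) (fpar a f)) u.
  by apply: contr_fZ => v /=; rewrite (upar_sad _ _ hy) formZ mulrA -expr2 sqrr_sign mul1r.
have -> : contr (fpar b (fpar a f)) u = contr (fpar a (fpar b f)) u.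
  by apply: contr_ext => v /=; rewrite uparC.
have -> : contr (fpar (b (+) a) f) u = contr (fpar a (fpar b f)) u.
  by apply: contr_ext => v /=; rewrite upar_upar.
rewrite linearZ /=; move: (sad b y _) (sad b y _) => S1 S2.
rewrite !mulrDr !scalerDr scalerA -expr2 sqrr_sign scale1r -!scalerAr.
by abel.
Qed.

End Contraction.

(** * The filtration by length *)

Section Filtration.
Variables (K : numFieldType) (L : lieSuperType K).
Local Notation U := (uea L).
Implicit Types (u v w : U) (x y : L) (f g : uform L).
Local Notation shift x := (fcomp (@lmul K L x)).

(** Words of length less than n span fil n. The index is shifted by one from
    the usual one so that descending along the filtration ends at fil 0 = 0. *)
Inductive fil : nat -> U -> Prop :=
| fil_0 n : fil n 0
| fil_1 n : fil n.+1 1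
| fil_lin n c u v : fil n u -> fil n v -> fil n (c *: u + v)
| fil_hom n d x u : hom d x -> fil n u -> fil n.+1 (uin x * u).

Lemma fil_D n u v : fil n u -> fil n v -> fil n (u + v).
Proof. by move=> /(fil_lin 1) h /h; rewrite scale1r. Qed.

Lemma fil_Z n c u : fil n u -> fil n (c *: u).
Proof. by move=> /(fil_lin c) /(_ (fil_0 n)); rewrite addr0. Qed.

Lemma fil_sum n (I : finType) (F : I -> U) :
  (forall i, fil n (F i)) -> fil n (\sum_i F i).
Proof. by move=> h; elim/big_rec: _ => [|i u _]; [exact: fil_0|exact: fil_D]. Qed.

Lemma fil_in n x u : fil n u -> fil n.+1 (uin x * u).
Proof.
move=> hu; rewrite -[x]hpart_sum linearD mulrDl.
by apply: fil_D; apply: fil_hom hu; exact: hom_hpart.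
Qed.

Lemma fil0P u : fil 0 u -> u = 0.
Proof.
move em: 0%N => m h; elim: h em => {m u} [n|n|n c u v _ hu _ hv|n d x u hx _ _] //.
by move=> en; rewrite (hu en) (hv en) scaler0 addr0.
Qed.

Lemma filS n u : fil n u -> fil n.+1 u.
Proof.
elim=> {n u} [n|n|n c u v _ hu _ hv|n d x u hx _ hu].
- exact: fil_0.
- exact: fil_1.
- exact: fil_lin.
- exact: fil_hom hx hu.
Qed.

Lemma fil_leq m n u : (m <= n)%N -> fil m u -> fil n u.
Proof. by move=> /subnK <-; elim: (n - m)%N => // k IH /IH; exact: filS. Qed.

Lemma fil1P u : fil 1 u -> exists c, u = c%:A.
Proof.
move em: 1%N => m h; elim: h em => {m u} [n|n|n c u v _ hu _ hv|n d x u hx hu _] en.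
- by exists 0; rewrite scale0r.
- by exists 1; rewrite scale1r.
- have [a ->] := hu en; have [b ->] := hv en; exists (c * a + b).
  by rewrite scalerDl scalerA.
by exists 0; case: en hu => <- /fil0P ->; rewrite mulr0 scale0r.
Qed.

Lemma fil_exists u : exists n, fil n u.
Proof.
elim/uea_ind: u => [c u v [m hu] [n hv]||d x u hx [n hu]].
- exists (maxn m n); apply: fil_lin; first exact: fil_leq (leq_maxl _ _) hu.
  exact: fil_leq (leq_maxr _ _) hv.
- by exists 1%N; exact: fil_1.
- by exists n.+1; exact: fil_hom hx hu.
Qed.

(** Translating f by x creates the value f(x) at 1; the counit, which contracts
    to the identity, takes it away. *)
Definition reduced f x := fcomb (- f (uin x)) (counit L) (shift x f).

Lemma reduced1 f x : reduced f x 1 = 0.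
Proof. by rewrite /= counit1 /lmul !mulr1 addNr. Qed.

Lemma contr_in_reduced d x f u : hom d x ->
  contr f (uin x * u)
  = f (uin x) *: u + contr (reduced f x) u + uin x * contr (fcomp (upar d) f) u.
Proof.
move=> hx; rewrite (contr_inM _ _ hx).
rewrite (contr_flinear u (c := - f (uin x)) (f := counit L) (g := shift x f)
  (h := reduced f x)) //.
by rewrite contr_counit addrA -scalerDl addrN scale0r add0r.
Qed.

(** A form vanishing at 1 has to meet at least one letter of a word. *)
Lemma contr_fil f n u : f 1 = 0 -> fil n u -> fil n.-1 (contr f u).
Proof.
move=> f1 hu; elim: hu f f1 => {n u} [n|n|n c u v _ hu _ hv|n d x u hx Fu hu] f f1.
- by rewrite linear0; exact: fil_0.
- by rewrite contr1 f1 scale0r; exact: fil_0.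
- by rewrite linearP /=; apply: fil_lin; auto.
rewrite (contr_in_reduced _ _ hx).
case: n Fu hu => [/fil0P -> _|n Fu hu] /=.
  by rewrite scaler0 !linear0 mulr0 !addr0; exact: fil_0.
apply: fil_D; first apply: fil_D.
- exact: fil_Z.
- by apply/filS/hu; exact: reduced1.
- by apply/fil_in/hu; rewrite /= rmorph1.
Qed.

(** A form vanishing at 1 and on single letters has to meet at least two. Hence
    the leading part of a contraction depends only on the restriction to L. *)
Lemma contr_fil2 f n u : f 1 = 0 -> (forall x, f (uin x) = 0) ->
  fil n u -> fil n.-2 (contr f u).
Proof.
move=> f1 fL hu; elim: hu f f1 fL => {n u}
  [n|n|n c u v _ hu _ hv|n d x u hx Fu hu] f f1 fL.
- by rewrite linear0; exact: fil_0.
- by rewrite contr1 f1 scale0r; exact: fil_0.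
- by rewrite linearP /=; apply: fil_lin; auto.
rewrite (contr_in_reduced _ _ hx) fL scale0r add0r.
have par1 : fcomp (upar d) f 1 = 0 by rewrite /= rmorph1.
case: n Fu hu => [/fil0P -> _|n Fu hu] /=.
  by rewrite !linear0 mulr0 !addr0; exact: fil_0.
apply: fil_D; first by apply: (contr_fil _ Fu); exact: reduced1.
case: n Fu hu => [Fu _|n Fu hu] /=.
  by rewrite (fil0P (contr_fil par1 Fu)) mulr0; exact: fil_0.
apply/fil_in/hu => // y /=.
by rewrite -[y]hpart_sum !linearD /= !(upar_in _ (hom_hpart _ _)) formD !formZ !fL
  !mulr0 addr0.
Qed.

Section Frame.
Variables (I : finType) (e : I -> L) (p : I -> bool) (f : I -> uform L).

(** A homogeneous basis e of L, or any spanning family, together with linear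
    forms on the enveloping algebra extending the coordinates. That the
    coordinates extend says that L embeds into U, apart from the scalars. *)
Record frame : Prop := Frame {
  frame_hom : forall i, hom (p i) (e i);
  frame_fhom : forall i, fhom (p i) (f i);
  frame1 : forall i, f i 1 = 0;
  frame_sum : forall x, \sum_i f i (uin x) *: e i = x
}.

Hypothesis eP : frame.

Definition euler u : U := \sum_i uin (e i) * contr (f i) u.

Fact euler_is_linear : linear euler.
Proof.
move=> c u v; rewrite /euler scaler_sumr -big_split; apply: eq_bigr => i _ /=.
by rewrite linearP mulrDr -scalerAr.
Qed.
HB.instance Definition _ :=
  GRing.isLinear.Build K U U *:%R euler euler_is_linear.

(** Euler's identity for homogeneous polynomials, up to shorter words: each
    letter is removed once and put back in front. *)
Lemma eulerP n u : fil n u -> fil n.-1 (euler u - n.-1%:R *: u).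
Proof.
elim=> {n u} [n|n|n c u v _ hu _ hv|n d x u hx Fu hu].
- by rewrite linear0 scaler0 subr0; exact: fil_0.
- rewrite {1}/euler big1 => [|i _]; last by rewrite contr1 (frame1 eP) scale0r mulr0.
  rewrite sub0r -scaleNr; case: n => [|n]; last by apply/fil_Z/fil_1.
  by rewrite oppr0 scale0r; exact: fil_0.
- rewrite linearP /= [X in _ - X]scalerDr opprD addrACA scalerA mulrC -scalerA.
  by rewrite -scalerBr; exact: fil_lin.
case: n Fu hu => [/fil0P -> _|n Fu hu] /=.
  by rewrite mulr0 linear0 scaler0 subr0; exact: fil_0.
have -> : euler (uin x * u) - n.+1%:R *: (uin x * u)
  = uin x * (euler u - n%:R *: u)
    + \sum_i (uin (e i) * contr (reduced (f i) x) u
              + (-1) ^+ (p i && d) *: (uin (sbr (e i) x) * contr (f i) u)).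
  rewrite mulrBr -scalerAr mulr_sumr addrAC -big_split /=.
  rewrite -addn1 natrD scalerDl scale1r opprD [- _ - _]addrC addrA.
  congr (_ - _).
  rewrite -{2}(frame_sum eP x) linear_sum mulr_suml -sumrB /=.
  apply: eq_bigr => i _.
  rewrite (contr_in_reduced _ _ hx) (contr_par _ _ (frame_fhom eP i)).
  rewrite (uin_sbr (frame_hom eP i) hx) linearZ /= -scalerAl !mulrDr mulrBl.
  rewrite -!(scalerAr, scalerAl) scalerBr scalerA -expr2 sqrr_sign scale1r.
  rewrite [d && _]andbC !mulrA.
  by abel.
apply: fil_D; first exact: fil_in.
apply: fil_sum => i; apply: fil_D; first by apply/fil_in/(contr_fil (reduced1 _ _) Fu).
by apply/fil_Z/fil_in/(contr_fil (frame1 eP i) Fu).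
Qed.

(** Taylor's formula: by Euler's identity an element of top degree n is
    recovered, modulo shorter words and up to the factor n, from its first
    derivatives, so that it is short as soon as all derivatives of order n
    vanish. *)
Lemma frame_detect n z : fil n.+1 z ->
  (forall s : seq I, size s = n -> foldr (fun i u => contr (f i) u) z s = 0) ->
  fil n z.
Proof.
elim: n z => [|n IH] z Fz Tz; first by have /= -> := Tz [::] erefl; exact: fil_0.
have h : fil n.+1 (euler z).
  apply: fil_sum => i; apply/fil_in/IH; first exact: contr_fil (frame1 eP i) Fz.
  by move=> s ss; rewrite -(foldr_rcons (fun i u => contr (f i) u)) Tz // size_rcons ss.
have := fil_lin (-1) (eulerP Fz) h; rewrite scaleN1r opprB subrK => /(fil_Z n.+1%:R^-1).
by rewrite scalerA mulVf ?scale1r // pnatr_eq0.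
Qed.

End Frame.
End Filtration.

(** * Odd supercentral elements *)

Section OddCenter.
Variables (K : numFieldType) (L : lieSuperType K).
Local Notation U := (uea L).
Implicit Types (u v w z : U) (x y : L) (f g : uform L).
Implicit Types hs t : seq (bool * uform L).

(** Forms are tagged with a parity so that odd and even ones can be counted in
    a list; the zero form has both parities. *)
Definition homform (q : bool * uform L) := fhom q.1 q.2 /\ q.2 1 = 0.

Fixpoint homforms hs :=
  if hs is q :: t then homform q /\ homforms t else True.

Fixpoint contrs hs u :=
  if hs is q :: t then contr q.2 (contrs t u) else u.

Fact contrs_is_linear hs : linear (contrs hs).
Proof. by elim: hs => //= q hs IH c u v; rewrite IH linearP. Qed.
HB.instance Definition _ hs :=
  GRing.isLinear.Build K U U *:%R (contrs hs) (contrs_is_linear hs).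

Definition nodd hs := count (fun q => q.1) hs.
Definition neven hs := count (fun q => ~~ q.1) hs.

Lemma contrs_fil hs n u : homforms hs -> fil (size hs + n) u -> fil n (contrs hs u).
Proof.
elim: hs n => //= q hs IH n [[_ q1] hhs]; rewrite addSnnS => Fu.
exact: (contr_fil q1 (IH _ hhs Fu)).
Qed.

Lemma uparity_contrs hs u : homforms hs ->
  uparity (contrs hs u) = (-1) ^+ odd (nodd hs) *: contrs hs (uparity u).
Proof.
elim: hs u => [|q hs IH] u /=; first by rewrite expr0 scale1r.
move=> [[hq _] hhs]; rewrite -[uparity _]/(upar true _) upar_contr (contr_par _ _ hq).
by rewrite /= (IH _ hhs) linearZ /= scalerA oddD -signr_addb; case: q.1.
Qed.

(** Contractions by even forms commute with all contractions, so the first odd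
    form can be moved to the front. *)
Lemma contrs_pull_odd hs : homforms hs -> (0 < nodd hs)%N ->
  exists g t, [/\ homform (true, g), homforms t, nodd hs = (nodd t).+1,
    neven hs = neven t
    & forall u, exists c, contrs hs u = c *: contr g (contrs t u)].
Proof.
elim: hs => //= -[[] f] hs IH [hf hhs] /=.
  by move=> _; exists f, hs; split=> // u; exists 1; rewrite scale1r.
rewrite add0n => /(IH hhs)[g [t [hg ht eo ee tE]]].
exists g, ((false, f) :: t); split=> //=; first by rewrite ee.
move=> u; have [c ->] := tE u; exists c.
by rewrite linearZ /= (contrC _ hf.1 hg.1) expr0 scale1r.
Qed.

(** Moving the superderivation [y, _] through a composite of contractions
    produces terms in which one form is replaced by its coadjoint image; since
    y is odd, that form changes parity. The subspace N collects the terms that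
    are known to vanish where the lemma is applied. *)
Lemma contrs_sad (N : U -> Prop) hs y u : hom true y -> homforms hs ->
  (forall c v w, N v -> N w -> N (c *: v + w)) -> N 0 ->
  (forall t, homforms t -> size t = size hs ->
     (nodd t = (nodd hs).+1 /\ neven hs = (neven t).+1) \/
     (nodd hs = (nodd t).+1 /\ neven t = (neven hs).+1) ->
     N (contrs t u)) ->
  exists b : bool, N (contrs hs (sad true y u) - (-1) ^+ b *: sad true y (contrs hs u)).
Proof.
move=> hy; elim: hs N => [|[d f] hs IH] N /=.
  by move=> _ _ N0 _; exists false; rewrite expr0 scale1r subrr.
move=> [hf hhs] Nlin N0 Nt.
have [|||b Nb] := IH (fun v => N (contr f v)) hhs.
- by move=> c v w Nv Nw; rewrite linearP; exact: Nlin.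
- by rewrite linear0.
- move=> t ht st ct; apply: (Nt ((d, f) :: t)) => //=; first by rewrite st.
  by case: ct => [[-> ->]|[-> ->]]; [left|right]; rewrite !addnS.
exists (b (+) d).
have Nf : N (contr (fcomp (sad true y) f) (contrs hs u)).
  apply: (Nt ((~~ d, fcomp (sad true y) f) :: hs)) => //=.
    split=> //; split; last by rewrite /= sad1 form0.
    by have := fhom_sad hy hf.1; rewrite addbT.
  by case: d {hf Nt} => /=; [right|left]; rewrite !(add0n, add1n).
have := Nlin ((-1) ^+ b) _ _ Nf Nb; rewrite linearB linearZ /= (contr_sad _ _ hy).
rewrite (contr_par _ _ hf.1) [sad true y (_ *: _)]linearZ /=.
by rewrite scalerDr opprD scalerA -signr_addb [X in N X -> _]addrCA addNKr.
Qed.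

Variables (I : finType) (e : I -> L) (p : I -> bool) (f : I -> uform L).
Hypothesis eP : frame e p f.
Variable f0 : uform L.
Hypothesis f0P : homform (false, f0).
Hypothesis f0_nondeg : forall g, homform (true, g) ->
  exists y, hom true y /\ forall x, f0 (sad true y (uin x)) = g (uin x).

Lemma iter_contr_linear n c u v :
  iter n (contr f0) (c *: u + v) = c *: iter n (contr f0) u + iter n (contr f0) v.
Proof. by elim: n => //= n ->; rewrite linearP. Qed.

Lemma iter_contr_fil n m u : fil (n + m) u -> fil m (iter n (contr f0) u).
Proof.
elim: n m => //= n IH m; rewrite addSnnS => /IH.
exact: (contr_fil f0P.2).
Qed.

(** As f0 is even, all the correction terms of this commutation are equal,
    whence the factor n + 1. *)
Lemma iter_contr_sad n y u : hom true y ->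
  iter n.+1 (contr f0) (sad true y u)
  = sad true y (iter n.+1 (contr f0) u)
    + n.+1%:R *: iter n (contr f0) (contr (fcomp (sad true y) f0) u).
Proof.
move=> hy.
have step v : contr f0 (sad true y v)
    = sad true y (contr f0 v) + contr (fcomp (sad true y) f0) v.
  by rewrite (contr_sad _ _ hy) (contr_par _ _ f0P.1) expr0 scale1r addrC.
have comm v : contr f0 (contr (fcomp (sad true y) f0) v)
    = contr (fcomp (sad true y) f0) (contr f0 v).
  by rewrite (contrC _ f0P.1 (fhom_sad hy f0P.1)) expr0 scale1r.
have iterC m v : iter m (contr f0) (contr (fcomp (sad true y) f0) v)
    = contr (fcomp (sad true y) f0) (iter m (contr f0) v).
  by elim: m => //= m ->; rewrite comm.
elim: n => [|n IH]; first by rewrite /= step scale1r.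
rewrite [LHS]iterS IH linearD /= [contr f0 (_ *: _)]linearZ /= step -addrA !iterC comm.
congr (_ + _).
by rewrite -[in RHS]natr1 scalerDl scale1r addrC.
Qed.

Variable z : U.
Hypothesis z_odd : uparity z = - z.
Hypothesis z_central : forall y, hom true y -> sad true y z = 0.

Lemma size_nodd_neven hs : size hs = (nodd hs + neven hs)%N.
Proof. by rewrite -(count_predC (fun q => q.1)). Qed.

(** The derivatives of order n of the leading part of z are considered at the
    point f0: those with the least number of odd directions come first and,
    for a given number of odd directions, those with the most directions equal
    to f0. Let g be an odd direction and write g = [f0, y] on L for an odd y,
    by nondegeneracy. Trading g for f0 and applying [y, z] = 0 gives a relation
    in which g reappears with a positive multiplicity; the other terms replace
    an even direction by an odd one, hence involve f0 once more, or an odd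
    direction by an even one, so that they vanish by induction. If no odd
    direction is left, or an even number of them, the derivative is a scalar
    of odd parity. *)
Lemma odd_central_contrs n a hs : fil n.+1 z ->
  homforms hs -> (a + size hs)%N = n -> iter a (contr f0) (contrs hs z) = 0.
Proof.
move=> Fz; have [m] := ubnP (nodd hs); elim: m a hs => // m IHj a hs.
have [k] := ubnP (neven hs); elim: k a hs => // k IHi a hs ek om hhs an.
have [odd_j|even_j] := boolP (odd (nodd hs)); last first.
  have [c Tc] : exists c, iter a (contr f0) (contrs hs z) = c%:A.
    by apply/fil1P/iter_contr_fil/(contrs_fil hhs); rewrite addnA addn1 addnC an.
  have : uparity (iter a (contr f0) (contrs hs z)) = - iter a (contr f0) (contrs hs z).
    elim: a {an Tc} => /= [|a IH].
      by rewrite (uparity_contrs _ hhs) (negbTE even_j) expr0 scale1r z_odd linearN.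
    rewrite -[uparity _]/(upar true _) upar_contr (contr_par _ _ f0P.1) expr0 scale1r.
    by rewrite /= IH linearN.
  rewrite Tc linearZ /= rmorph1 => /eqP; rewrite -subr_eq0 opprK -mulr2n.
  by rewrite -scaler_nat scaler_eq0 pnatr_eq0 /= => /eqP.
have iter0 b : iter b (contr f0) 0 = 0 by elim: b => //= b ->; rewrite linear0.
have [g [t [hg ht oE eE tE]]] := contrs_pull_odd hhs (odd_gt0 odd_j).
have st : size hs = (size t).+1 by rewrite !size_nodd_neven oE eE.
have [c ->] := tE z.
rewrite [iter _ _ _](_ : _ = c *: iter a (contr f0) (contr g (contrs t z))); last first.
  by rewrite -[_ *: contr g _]addr0 iter_contr_linear iter0 addr0.
have [y [hy gy]] := f0_nondeg hg.
(* Of the n letters of z, the a + 1 ones not used up by t are left. *)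
have Fw : fil a.+2 (contrs t z).
  by apply: (contrs_fil ht); rewrite !addnS -addSn addnC -st an.
have sad0 : iter a.+1 (contr f0) (sad true y (contrs t z)) = 0.
  have [|||b] := @contrs_sad (fun v => iter a.+1 (contr f0) v = 0) t y z hy ht.
  - by move=> c' v w hv hw; rewrite iter_contr_linear hv hw scaler0 addr0.
  - exact: iter0.
  - move=> t' ht' st' ct; have an' : (a.+1 + size t')%N = n by rewrite st' addSnnS -st.
    case: ct => -[o1 e1].
      by apply: IHi => //; [rewrite -ltnS -e1 -eE | rewrite o1 -oE].
    by apply: IHj => //; rewrite -ltnS; apply: leq_ltn_trans om; rewrite oE o1.
  rewrite z_central // linear0 sub0r -scaleNr -[X in iter _ _ X]addr0 iter_contr_linear.
  by rewrite iter0 addr0 => /eqP; rewrite scaler_eq0 oppr_eq0 signr_eq0 => /eqP.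
(* iter a.+1 (contr f0) (contrs t z) is a scalar, hence killed by [y, _]. *)
have lie_part : iter a (contr f0) (contr (fcomp (sad true y) f0) (contrs t z)) = 0.
  have := iter_contr_sad a (contrs t z) hy.
  have [c' ->] : exists c', iter a.+1 (contr f0) (contrs t z) = c'%:A.
    by apply/fil1P/iter_contr_fil; rewrite addn1.
  rewrite sad0 linearZ /= sad1 scaler0 add0r => /esym/eqP.
  by rewrite scaler_eq0 pnatr_eq0 => /eqP.
(* g and the coadjoint image of f0 agree on L, which is all that matters in
   top degree. *)
have : iter a (contr f0)
    (contr (fcomb (-1) (fcomp (sad true y) f0) g) (contrs t z)) = 0.
  apply/fil0P/iter_contr_fil; rewrite addn0.
  apply: (contr_fil2 _ _ Fw) => [|x] /=; first by rewrite sad1 form0 mulr0 add0r hg.2.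
  by rewrite gy mulN1r addNr.
rewrite (contr_flinear _ (c := -1) (f := fcomp (sad true y) f0) (g := g)) //.
by rewrite iter_contr_linear lie_part scaler0 add0r => ->; rewrite scaler0.
Qed.

Theorem odd_central_eq0 : z = 0.
Proof.
have step n : fil n.+1 z -> fil n z.
  move=> Fz; apply: (frame_detect eP Fz) => s ss.
  have := @odd_central_contrs n 0 [seq (p i, f i) | i <- s] Fz.
  rewrite size_map ss add0n => /= h; rewrite -[RHS]h //.
    by elim: s {ss h} => //= i s ->.
  elim: s {ss h} => //= i s IH; split=> //.
  by split; [exact: frame_fhom eP i | exact: frame1 eP i].
have [n] := fil_exists z; elim: n => [|n IH] Fz; first exact: fil0P.
exact/IH/step.
Qed.

End OddCenter.

(** * A criterion for the absence of odd supercentral elements *)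

Section Criterion.
Variables (K : numFieldType) (L : lieSuperType K).
Local Notation U := (uea L).
Implicit Types (u v w z : U) (x y : L) (f g : uform L).

Fact hform_lin d f c u v :
  2^-1 * (f (c *: u + v) + (-1) ^+ nat_of_bool d * f (uparity (c *: u + v)))
  = c * (2^-1 * (f u + (-1) ^+ d * f (uparity u)))
    + 2^-1 * (f v + (-1) ^+ d * f (uparity v)).
Proof. by rewrite linearP /= !form_lin; ring. Qed.
Definition hform d f := Form (hform_lin d f).

Lemma hform1 d f : f 1 = 0 -> hform d f 1 = 0.
Proof. by move=> f1; rewrite /= rmorph1 f1 mulr0 addr0 mulr0. Qed.

Lemma fhom_hform d f : fhom d (hform d f).
Proof.
by move=> u /=; rewrite uparityK; case: d; rewrite /= ?expr0 ?expr1; ring.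
Qed.

Lemma half2 (a : K) : 2^-1 * (a + a) = a.
Proof. by rewrite -mulr2n -(mulr_natl a) mulrA mulVf ?mul1r // pnatr_eq0. Qed.

Lemma hform_in d f x : hform d f (uin x) = f (uin (hpart d x)).
Proof.
rewrite /= -{1 2}[x]hpart_sum !linearD /= !uparity_in !formD !formZ expr0 expr1.
rewrite mul1r mulN1r; case: d.
  by rewrite expr1 mulN1r opprD opprK addrACA addrN add0r half2.
by rewrite expr0 mul1r addrACA addrN addr0 half2.
Qed.

Lemma fhom_in d f x : fhom d f -> f (uin x) = f (uin (hpart d x)).
Proof.
move=> hf; have h2 := hf (uin (hpart (~~ d) x)).
rewrite -{1}[x]hpart_sum linearD formD; move: h2; rewrite uparity_in formZ.
case: d {hf} => /= /eqP; rewrite expr0 expr1 !mul1r !mulN1r.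
  rewrite -subr_eq0 opprK -mulr2n mulrn_eq0 => /eqP ->; exact: add0r.
rewrite eq_sym -subr_eq0 opprK -mulr2n mulrn_eq0 => /eqP ->; exact: addr0.
Qed.

Variables (J : finType) (E : J -> L) (G : J -> uform L).

(** Nondegeneracy of (y, x) |-> l [y, x] on the odd part, which is meant to be
    finite-dimensional: then surjectivity onto the dual is nondegeneracy. *)
Definition odd_nondeg (l : L -> K) := forall g : {linear L -> K^o},
  exists y, hom true y /\ forall x, hom true x -> l (sbr y x) = g x.

(** A frame without homogeneity; its homogeneous components form a frame. *)
Definition framing :=
  (forall j, G j 1 = 0) /\ forall x, \sum_j G j (uin x) *: E j = x.

Hypothesis EG : framing.

Lemma framing_frame :
  frame (fun i : J * bool => hpart i.2 (E i.1)) snd (fun i => hform i.2 (G i.1)).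
Proof.
split=> [i|i|i|x]; [exact: hom_hpart|exact: fhom_hform|exact/hform1/EG.1|].
transitivity (\sum_j \sum_(d : bool) G j (uin (hpart d x)) *: hpart d (E j)).
  by rewrite pair_big; apply: eq_bigr => i _; rewrite hform_in.
rewrite exchange_big -[RHS]hpart_sum big_bool addrC.
have part d : \sum_j G j (uin (hpart d x)) *: hpart d (E j) = hpart d x.
  rewrite -[RHS](hom_hpart d x) -[in RHS](EG.2 (hpart d x)) linear_sum.
  by apply: eq_bigr => j _; rewrite linearZ.
by rewrite !part.
Qed.

Fact framed_form_lin (l : L -> K) c u v :
  \sum_j l (E j) * G j (c *: u + v)
  = c * (\sum_j l (E j) * G j u) + \sum_j l (E j) * G j v.
Proof.
rewrite mulr_sumr -big_split; apply: eq_bigr => j _ /=.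
by rewrite form_lin; ring.
Qed.
Definition framed_form l := Form (framed_form_lin l).

Lemma framed_form1 l : framed_form l 1 = 0.
Proof. by rewrite /= big1 // => j _; rewrite EG.1 mulr0. Qed.

Lemma framed_form_in (l : {linear L -> K^o}) x : framed_form l (uin x) = l x.
Proof.
rewrite -{2}(EG.2 x) linear_sum; apply: eq_bigr => j _.
by rewrite linearZ /= mulrC.
Qed.

(** In the limit of large even part, where it acts through the point l, the
    enveloping algebra looks like the Clifford algebra of the form l [y, x]; if
    this form is nondegenerate, the supercentre of the Clifford algebra consists
    of the scalars, which are even. *)
Lemma odd_supercentral_eq0 (l : {linear L -> K^o}) : odd_nondeg l ->
  forall z, supercenter L z -> uparity z = - z -> z = 0.
Proof.
move=> nondeg z /supercenterP Zz zodd.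
pose f0 := hform false (framed_form l).
apply: (odd_central_eq0 framing_frame (f0 := f0)) => //.
- by split; [exact: fhom_hform | apply/hform1/framed_form1].
- move=> g [gh _].
  have glin : linear (fun x => g (uin x) : K^o).
    by move=> c x y; rewrite linearP form_lin.
  pose gl : {linear L -> K^o} := HB.pack (fun x => g (uin x) : K^o)
    (GRing.isLinear.Build K L K^o *:%R _ glin).
  have [y [hy gy]] := nondeg gl; exists y; split=> // x.
  rewrite [RHS](fhom_in _ gh) -[RHS]/(gl (hpart true x)) -gy; last exact: hom_hpart.
  have -> : sad true y (uin x) = uin (sbr y x).
    rewrite -{1}[x]hpart_sum !linearD /= !(sad_in (hom_hpart _ x) hy).
    by rewrite -!linearD hpart_sum.
  rewrite hform_in framed_form_in -{1}[x]hpart_sum !linearD /=.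
  rewrite !(hom_other _ (hom_sbr hy (hom_hpart _ x))) /=.
  by rewrite linear0 add0r.
by move=> y; exact: Zz.
Qed.

End Criterion.

(** * Comparing centres across an odd hyperplane *)

Section Umap.
Variables (K : numFieldType) (M L : lieSuperType K) (i : M -> L).
Hypothesis iP : lsmorph i.
Implicit Types (a b u : uea M) (F : uform L).

Lemma umap_lin c a b : umap i (c *: a + b) = c *: umap i a + umap i b.
Proof. by have [l _ _ _] := umapP iP; exact: l. Qed.

Lemma umap1 : umap i 1 = 1.
Proof. by have [_ u1 _ _] := umapP iP. Qed.

Lemma umapM a b : umap i (a * b) = umap i a * umap i b.
Proof. by have [_ _ m _] := umapP iP; exact: m. Qed.

Lemma umap_in x : umap i (uin x) = uin (i x).
Proof. by have [_ _ _ n] := umapP iP; exact: n. Qed.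

Lemma umap0 : umap i 0 = 0.
Proof. by have := umap_lin (-1) 1 1; rewrite !scaleN1r !addNr. Qed.

Lemma umapD a b : umap i (a + b) = umap i a + umap i b.
Proof. by have := umap_lin 1 a b; rewrite !scale1r. Qed.

Lemma umapZ c a : umap i (c *: a) = c *: umap i a.
Proof. by have := umap_lin c a 0; rewrite umap0 !addr0. Qed.

Lemma umapN a : umap i (- a) = - umap i a.
Proof. by rewrite -scaleN1r umapZ scaleN1r. Qed.

Lemma umapB a b : umap i (a - b) = umap i a - umap i b.
Proof. by rewrite umapD umapN. Qed.

Lemma hom_lsmorph d x : hom d x -> hom d (i x).
Proof. by case: iP => _ ip _ hx; rewrite /hom -ip hx. Qed.

Lemma umap_upar d a : umap i (upar d a) = upar d (umap i a).
Proof.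
elim/uea_ind: a => [c a b ha hb||b x a hx IH].
- by rewrite !linearP /= !umap_lin ha hb linearP.
- by rewrite rmorph1 !umap1 rmorph1.
rewrite rmorphM !umapM !rmorphM /= (upar_in _ hx) umapZ !umap_in IH.
by rewrite (upar_in _ (hom_lsmorph hx)).
Qed.

Lemma umap_sad (b : bool) y a : umap i (sad b y a) = sad b (i y) (umap i a).
Proof. by rewrite /sad umapB !umapM umap_upar umap_in. Qed.

Fact fpull_lin F c a b :
  F (umap i (c *: a + b)) = c * F (umap i a) + F (umap i b).
Proof. by rewrite umap_lin form_lin. Qed.
Definition fpull F := Form (fpull_lin F).

Lemma umap_contr F a : umap i (contr (fpull F) a) = contr F (umap i a).
Proof.
elim/uea_ind: a F => [c a b ha hb||d x a hx IH] F.
- by rewrite linearP /= !umap_lin linearP /= ha hb.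
- by rewrite !(contr1, umap1, umapZ) /= umap1.
rewrite umapM umap_in (contr_inM _ _ hx) (contr_inM _ _ (hom_lsmorph hx)).
rewrite umapD umapM umap_in -!IH; congr (umap i _ + _ * umap i _).
  by apply: contr_ext => u /=; rewrite /lmul umapM umap_in.
by apply: contr_ext => u /=; rewrite umap_upar.
Qed.

(** If the coordinates of M extend to forms on U(L), the derivatives of a in
    U(M) can be computed after mapping to U(L), by naturality of contraction;
    so if a dies in U(L), all of them vanish. *)
Lemma umap_inj_framing (J : finType) (E : J -> M) (G : J -> uform L) a :
  framing E (fun j => fpull (G j)) -> umap i a = 0 -> a = 0.
Proof.
move=> /framing_frame fr; have [n] := fil_exists a.
elim: n => [Fa _|n IH Fa a0]; first exact: fil0P.
apply: IH => //; apply: (frame_detect fr Fa) => s ss.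
have [c sc] : exists c, foldr
    (fun q u => contr (hform q.2 (fpull (G q.1))) u) a s = c%:A.
  apply: fil1P; rewrite -ss -addn1 in Fa; move: (1%N) Fa => m {ss}.
  elim: s m => //= q s IHs m; rewrite addSnnS => /IHs.
  exact: (contr_fil (frame1 fr q)).
have us : umap i (foldr (fun q u => contr (hform q.2 (fpull (G q.1))) u) a s) = 0.
  elim: {ss sc} s => //= q s IHs.
  rewrite (@contr_ext _ _ _ (fpull (hform q.2 (G q.1)))) ?umap_contr ?IHs ?linear0 //.
  by move=> u /=; rewrite -[uparity (umap _ _)]/(upar true _) -umap_upar.
move: us; rewrite sc umapZ umap1 => /eqP.
by rewrite scaler_eq0 oner_eq0 orbF => /eqP ->; rewrite scale0r.
Qed.

End Umap.

Section SadTheory.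
Variables (K : numFieldType) (L : lieSuperType K).
Implicit Types (u v z : uea L) (x y : L).

Lemma sadM b y u v : sad b y (u * v) = sad b y u * v + upar b u * sad b y v.
Proof. by rewrite /sad rmorphM /= mulrBl mulrBr !mulrA addrA subrK. Qed.

Lemma sad_sad a b x y u : hom a x -> hom b y ->
  sad a x (sad b y u)
  = sad (a (+) b) (sbr x y) u + (-1) ^+ (a && b) *: sad b y (sad a x u).
Proof.
move=> hx hy; have xy := sad_in hy hx.
rewrite {2}/sad linearB /= !sadM xy (upar_in _ hy) upar_upar.
have -> : sad a x (upar b u) = (-1) ^+ (a && b) *: upar b (sad a x u).
  by rewrite (upar_sad _ _ hx) andbC scalerA -expr2 sqrr_sign scale1r.
rewrite [sad b y _]/sad [sad (a (+) b) _ _]/sad; move: (sad a x u) => v.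
rewrite -!scalerAl scalerBr.
by abel.
Qed.

Lemma supercentral_even z :
  (forall w, supercenter L w -> uparity w = - w -> w = 0) ->
  supercenter L z -> uparity z = z.
Proof.
move=> odd0 /supercenterP Zz; apply/eqP; rewrite -subr_eq0; apply/eqP/odd0.
  apply/supercenterP => b y hy; rewrite linearB /= Zz // subr0.
  have := upar_sad true z hy; rewrite Zz // linear0 => /esym/eqP.
  by rewrite scaler_eq0 signr_eq0 => /eqP.
by rewrite linearB /= uparityK opprB.
Qed.

End SadTheory.

Section Hyperplane.
Variables (K : numFieldType) (M L : lieSuperType K).
Variables (i : M -> L) (r : {linear L -> M}) (h : {linear L -> K^o}) (H : L).

(** M is an ideal of L of codimension 1 with odd quotient: h is the projection
    onto L/M, split by H, and r is the corresponding projection onto M. *)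
Record odd_hyperplane : Prop := OddHyperplane {
  oh_lsmorph : lsmorph i;
  oh_retract : forall y, r (i y) = y;
  oh_odd : hom true H;
  oh_dec : forall x, x = i (r x) + h x *: H;
  oh_i : forall y, h (i y) = 0;
  oh_H : h H = 1;
  oh_sbr : forall x y, h (sbr x y) = 0
}.

Hypothesis oh : odd_hyperplane.
Let iP := oh_lsmorph oh.
Local Notation um := (umap i).

Fact coef_action : @lie_action K L (K^o * K^o)%type (fun _ => True)
  (fun x v => (0, h x * v.1)).
Proof.
split=> // [x c v w _ _|v c x y _|a b x y v _]; congr pair => /=.
- by rewrite scaler0 addr0.
- by rewrite /GRing.scale /=; ring.
- by rewrite scaler0 addr0.
- by rewrite linearP mulrDl /GRing.scale /= mulrA.
- by rewrite scaler0 subr0.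
- by rewrite (oh_sbr oh) !(mulr0, mul0r) scaler0 subr0.
Qed.

(** The quotient L/M is an odd line with zero bracket, whose enveloping algebra
    is the exterior algebra with basis 1, H. The form is the coefficient of H
    there; the action above is left multiplication. *)
Fact coef_exists : exists f : uform L, [/\ fhom true f, f 1 = 0, f (uin H) = 1
  & forall d y u, hom d y -> f (uin (i y) * u) = 0].
Proof.
pose V : lmodType K := (K^o * K^o)%type.
pose m (u : uea L) (v : V) : V := mact (fun x v => (0, h x * v.1) : V) u v.
have flin c u v : (m (c *: u + v) (1, 0)).2 = c * (m u (1, 0)).2 + (m v (1, 0)).2.
  by rewrite /m (mact_linl coef_action).
pose f : uform L := Form flin.
have fi y u : f (uin (i y) * u) = 0.
  rewrite /f /= /m (mactM coef_action) // (mact_in coef_action) //=.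
  by rewrite (oh_i oh) mul0r.
have f1 : f 1 = 0 by rewrite /f /= /m (mact1 coef_action).
have fH : f (uin H) = 1.
  by rewrite /f /= /m (mact_in coef_action) //= (oh_H oh) mulr1.
clearbody f; exists (hform true f); split; first exact: fhom_hform.
- exact: hform1.
- by rewrite hform_in (oh_odd oh).
move=> d y u hy; rewrite /= fi rmorphM /= -[uparity (uin _)]/(upar true _).
by rewrite (upar_in _ (hom_lsmorph iP hy)) -scalerAl formZ fi !mulr0 addr0 mulr0.
Qed.

(** A form that kills M U(L) does not see the letters in M. *)
Lemma contr_coef f b w : fhom true f ->
  (forall d y u, hom d y -> f (uin (i y) * u) = 0) ->
  contr f (um b * w) = um (uparity b) * contr f w.
Proof.
move=> hf fi; elim/uea_ind: b w => [c a b ha hb||d x b hx IH] w.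
- by rewrite umap_lin // mulrDl -scalerAl linearP /= ha hb linearP /= umap_lin //
    mulrDl -scalerAl.
- by rewrite rmorph1 umap1 // !mul1r.
rewrite umapM // umap_in // -mulrA (contr_inM _ _ (hom_lsmorph iP hx)).
rewrite (@contr_fZ _ _ 0 f); last by move=> v /=; rewrite /lmul (fi d) // mul0r.
rewrite scale0r add0r (contr_par _ _ hf) IH rmorphM /= umapM //.
rewrite -[uparity (uin x)]/(upar true _) (upar_in _ hx) umapZ // umap_in // andbT.
by rewrite -scalerAr -!scalerAl !mulrA.
Qed.

Variables (J : finType) (E : J -> L) (G : J -> uform L).
Hypothesis EG : framing E G.

Lemma framing_retract : framing (fun j => r (E j)) (fun j => fpull iP (G j)).
Proof.
split=> [j|y] /=; first by rewrite umap1 // EG.1.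
rewrite -[RHS](oh_retract oh) -(EG.2 (i y)) linear_sum.
by apply: eq_bigr => j _; rewrite linearZ umap_in.
Qed.

Lemma um_inj a : um a = 0 -> a = 0.
Proof. exact: umap_inj_framing framing_retract. Qed.

(** Contraction by the coefficient of H turns um a + um b H into um b, up to the
    parity automorphism. Together with umap_span this says that U(L) is free
    over U(M) with basis 1, H. *)
Lemma umap_free a b : um a + um b * uin H = 0 -> a = 0 /\ b = 0.
Proof.
have [f [hf f1 fH fi]] := coef_exists => ab0.
have b0 : b = 0.
  apply/(can_inj (@uparityK K M)); rewrite linear0; apply: um_inj.
  have := congr1 (contr f) ab0; rewrite linear0 linearD /= -[um a]mulr1.
  rewrite !(contr_coef _ _ hf fi) contr1 f1 scale0r mulr0 add0r.
  rewrite -[uin H]mulr1 (contr_inM _ _ (oh_odd oh)) !contr1 /= /lmul mulr1 fH.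
  by rewrite scale1r rmorph1 f1 scale0r mulr0 addr0 mulr1.
split=> //; apply: um_inj; move: ab0.
by rewrite b0 umap0 // mul0r addr0.
Qed.

Lemma i_of_h0 x : h x = 0 -> x = i (r x).
Proof. by move=> hx; rewrite {1}(oh_dec oh x) hx scale0r addr0. Qed.

Lemma hom_i d y : hom d (i y) -> hom d y.
Proof.
case: iP => _ ip _ hy.
by apply: (can_inj (oh_retract oh)); rewrite ip hy.
Qed.

Lemma h_even x : hom false x -> h x = 0.
Proof.
move=> hx; rewrite -hx (oh_dec oh x) linearD linearZ /=.
rewrite (hom_other _ (oh_odd oh)) /= scaler0 addr0.
by case: iP => _ ip _; rewrite -ip oh_i.
Qed.

Lemma sad_H_um a : exists a', sad true H (um a) = um a'.
Proof.
elim/uea_ind: a => [c a b [a' ha] [b' hb]||d x a hx [a' ha]].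
- by exists (c *: a' + b'); rewrite umap_lin // linearP /= ha hb umap_lin.
- by exists 0; rewrite umap1 // sad1 umap0.
exists (uin (r (sbr H (i x))) * a + (-1) ^+ (d && true) *: (uin x * a')).
rewrite umapM // umap_in // (sad_inM _ (hom_lsmorph iP hx) (oh_odd oh)) ha.
rewrite umapD // umapZ // !umapM // !umap_in // -i_of_h0 //.
exact: oh_sbr.
Qed.

(** Left multiplication by H preserves U(M) + U(M) H because [H, U(M)] lies in
    U(M), and 2 H^2 = [H, H] in M. *)
Lemma umap_span u : exists a b, u = um a + um b * uin H.
Proof.
have HH : uin H * uin H = um (2^-1 *: uin (r (sbr H H))).
  rewrite umapZ // umap_in // -i_of_h0; last exact: oh_sbr.
  rewrite (uin_sbr (oh_odd oh) (oh_odd oh)) expr1 scaleN1r opprK -mulr2n.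
  by rewrite -scaler_nat scalerA mulVf ?scale1r // pnatr_eq0.
elim/uea_ind: u => [c u v [a [b ->]] [a' [b' ->]]||d x u hx [a [b ->]]].
- exists (c *: a + a'), (c *: b + b'); rewrite !umap_lin // mulrDl -scalerAl.
  by rewrite scalerDr addrACA.
- by exists 1, 0; rewrite umap1 // umap0 // mul0r addr0.
rewrite (oh_dec oh x) linearD linearZ /=.
have [a' Ha] := sad_H_um a; have [b' Hb] := sad_H_um b.
have Hum c c' : sad true H (um c) = um c' -> uin H * um c = um c' + um (uparity c) * uin H.
  by move=> <-; rewrite /sad -umap_upar //= subrK.
exists (uin (r x) * a + h x *: (a' + uparity b * (2^-1 *: uin (r (sbr H H))))).
exists (uin (r x) * b + h x *: (uparity a + b')).
rewrite umapD // umapZ // umapD // !umapM // -HH umapD // umapZ // umapD // umapM //.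
rewrite umap_in // !mulrDl !mulrDr -!scalerAl !mulrA (Hum _ _ Ha) (Hum _ _ Hb).
rewrite !mulrDl !scalerDr ?mulrA -?scalerAl.
by abel.
Qed.

Variable l : {linear L -> K^o}.
Hypothesis l_nondeg : odd_nondeg l.
Hypothesis li_nondeg : odd_nondeg (l \o i).

Lemma L_odd0 w : supercenter L w -> uparity w = - w -> w = 0.
Proof. exact: (odd_supercentral_eq0 EG l_nondeg). Qed.

Lemma M_odd0 w : supercenter M w -> uparity w = - w -> w = 0.
Proof.
have lin : linear (l \o i : M -> K^o).
  by move=> c x y; case: iP => il _ _; rewrite /= il linearP.
pose li : {linear M -> K^o} := HB.pack (l \o i : M -> K^o)
  (GRing.isLinear.Build K M K^o *:%R _ lin).
exact: (odd_supercentral_eq0 framing_retract (l := li) li_nondeg).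
Qed.

(** Write z = a + b H. As z is even, b is odd, and comparing coefficients of H
    in [x, z] = 0 for x in M shows that b is supercentral in U(M); so b = 0. *)
Lemma supercenter_sub z : supercenter L z -> exists2 a, supercenter M a & um a = z.
Proof.
move=> Zz; have zeven := supercentral_even L_odd0 Zz.
have [a [b zab]] := umap_span z.
have [ha hb] : uparity a - a = 0 /\ - (uparity b + b) = 0.
  apply: umap_free; have := zeven; rewrite zab linearD rmorphM /= => /eqP.
  rewrite -!/(upar true _) -!(umap_upar iP) (upar_in _ (oh_odd oh)) /= expr1 scaleN1r.
  rewrite -subr_eq0 => /eqP <-; rewrite umapB // umapN // umapD //.
  by rewrite mulNr mulrDl mulrN; abel.
have bodd : uparity b = - b by apply/eqP; rewrite -addr_eq0 -oppr_eq0 hb.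
have key d x : hom d x -> sad d x a = b * uin (r (sbr H (i x))) /\ sad d x b = 0.
  move=> hx.
  have [e1 e2] : sad d x a - b * uin (r (sbr H (i x))) = 0 /\ sad d x b = 0; last first.
    by split=> //; apply/eqP; rewrite -subr_eq0 e1.
  apply: umap_free.
  have hix := hom_lsmorph iP hx.
  have := (supercenterP z).1 Zz d _ hix; rewrite zab linearD /= sadM => <-.
  rewrite umapB // umapM // umap_in // -i_of_h0; last exact: oh_sbr.
  rewrite !umap_sad // -addrA; congr (_ + _).
  rewrite (sad_in (oh_odd oh) hix) -umap_upar //.
  have -> : upar d b = (-1) ^+ d *: b.
    by case: d {hx hix} => //=; rewrite ?expr0 ?expr1 ?scale1r ?scaleN1r.
  have -> : sbr (i x) H = - ((-1) ^+ d *: sbr H (i x)).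
    have := sbr_skew d true (i x) H; rewrite hix (oh_odd oh) andbT => ->.
    by [].
  rewrite umapZ // linearN linearZ /= -scalerAl mulrN -scalerAr scalerN scalerA.
  by rewrite -expr2 sqrr_sign scale1r addrC.
have b0 : b = 0.
  by apply: M_odd0 => //; apply/supercenterP => d x /key[].
exists a; last by rewrite zab b0 umap0 // mul0r addr0.
by apply/supercenterP => d x /key[->]; rewrite b0 mul0r.
Qed.

(** For a supercentral in U(M), the element [H, a] lies in U(M), is odd, and is
    again supercentral by the Jacobi identity; so it vanishes. *)
Lemma supercenter_super a : supercenter M a -> supercenter L (um a).
Proof.
move=> Za; have aeven := supercentral_even M_odd0 Za.
have um0 d y : hom d y -> h y = 0 -> sad d y (um a) = 0.
  move=> hy /i_of_h0 yi; move: hy; rewrite yi => /hom_i hy.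
  by rewrite -umap_sad // ((supercenterP a).1 Za) // umap0.
have H0 : sad true H (um a) = 0.
  have [w Hw] := sad_H_um a; rewrite Hw.
  suff -> : w = 0 by rewrite umap0.
  apply: M_odd0; last first.
    apply/eqP; rewrite -addr_eq0; apply/eqP/um_inj.
    rewrite umapD // -[uparity w]/(upar true w) umap_upar // -Hw.
    rewrite (upar_sad _ _ (oh_odd oh)) -umap_upar //= aeven expr1 scaleN1r.
    exact: addNr.
  apply/supercenterP => d x hx; apply: um_inj; have hix := hom_lsmorph iP hx.
  rewrite umap_sad // -Hw (sad_sad _ hix (oh_odd oh)) [sad d _ (um a)]um0 ?oh_i //.
  rewrite linear0 scaler0 addr0; apply: um0; last exact: oh_sbr.
  exact: hom_sbr hix (oh_odd oh).
apply/supercenterP => d y hy; case: d hy => hy; last exact: um0 hy (h_even hy).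
have hy' : hom true (i (r y)).
  have -> : i (r y) = y - h y *: H by rewrite {2}(oh_dec oh y) addrK.
  by rewrite /hom linearB linearZ /= hy (oh_odd oh).
have := um0 _ _ hy' (oh_i oh _).
rewrite {2}(oh_dec oh y) /sad linearD linearZ /= mulrDl mulrDr => e.
have := H0; rewrite /sad => e'.
rewrite -scalerAl -scalerAr opprD addrACA e add0r -scalerBr e'.
exact: scaler0.
Qed.

Theorem supercenter_hyperplane : supercenter L = (um @` supercenter M)%classic.
Proof.
apply/seteqP; split=> [z /supercenter_sub[a Za <-]|_ [a Za <-]]; first by exists a.
exact: supercenter_super.
Qed.

End Hyperplane.

(** * Quotients *)

Section Quotient.
Variables (K : numFieldType) (L : lieSuperType K) (I : lieIdeal L).
Local Notation pi := (lpi I).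

Lemma lquot_lift (V : lmodType K) (f : {linear L -> V}) :
  (forall x, x \in ideal_pred I -> f x = 0) ->
  exists g : {linear lquot I -> V}, forall x, g (pi x) = f x.
Proof.
move=> fI; pose g (u : lquot I) := f (repr u).
have gE x : g (pi x) = f x.
  by apply/eqP; rewrite -subr_eq0 -linearB fI //; exact: repr_lpi.
have glin : linear g.
  move=> c u v; have [x ->] := lpi_surj u; have [y ->] := lpi_surj v.
  by rewrite -linearP /= !gE linearP.
by exists (HB.pack_for {linear lquot I -> V} g
  (GRing.isLinear.Build K (lquot I) V *:%R g glin)).
Qed.

Lemma hom_lpi d x : hom d x -> hom d (pi x).
Proof. by move=> hx; have [_ ph _] := lpi_lsmorph I; rewrite /hom -ph hx. Qed.

Lemma lpi_hom d u : hom d u -> exists2 x, hom d x & u = pi x.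
Proof.
move=> hu; have [x ux] := lpi_surj u; exists (hpart d x); first exact: hom_hpart.
by have [_ ph _] := lpi_lsmorph I; rewrite ph -ux hu.
Qed.

Lemma odd_nondeg_quot (l : L -> K) (k : lquot I -> K) :
  (forall x, k (pi x) = l x) -> odd_nondeg l -> odd_nondeg k.
Proof.
move=> kl nd g; have [y [hy gy]] := nd (g \o pi); exists (pi y).
split=> [|u /lpi_hom[x hx ->]]; first exact: hom_lpi.
by have [_ _ ps] := lpi_lsmorph I; rewrite -ps kl gy.
Qed.

End Quotient.

Lemma odd_hyperplane_quot (K : numFieldType) (M L : lieSuperType K)
    (i : M -> L) (r : {linear L -> M}) (h : {linear L -> K^o}) (H : L)
    (I : lieIdeal L) (J : lieIdeal M) (i' : lquot J -> lquot I) :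
  odd_hyperplane i r h H -> lsmorph i' ->
  (forall y, i' (lpi J y) = lpi I (i y)) ->
  (forall x, x \in ideal_pred I -> h x = 0 /\ r x \in ideal_pred J) ->
  exists r' h', odd_hyperplane i' r' h' (lpi I H).
Proof.
move=> [_ ri oH dec hi hH hs] i'P i'E hrI.
have rI x : x \in ideal_pred I -> (lpi J \o r) x = 0.
  by move=> /hrI[_ rx]; rewrite /= -(linear0 (lpi J)); apply/lpiP; rewrite subr0.
have [r' r'E] := lquot_lift rI.
have [h' h'E] := @lquot_lift K L I _ h (fun x xI => (hrI x xI).1).
have [_ _ ps] := lpi_lsmorph I.
exists r', h'; split=> //.
- by move=> u; have [y ->] := lpi_surj u; rewrite i'E r'E /= ri.
- exact: hom_lpi.
- move=> u; have [x ->] := lpi_surj u; rewrite r'E h'E i'E /=.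
  by rewrite -linearZ -linearD /= -dec.
- by move=> u; have [y ->] := lpi_surj u; rewrite i'E h'E.
- by rewrite h'E.
- move=> u v; have [x ->] := lpi_surj u; have [y ->] := lpi_surj v.
  by rewrite -ps h'E.
Qed.

(** Representations of L provide linear maps R on U whose restriction to L is
    injective; subtracting multiples of the counit makes the resulting forms
    vanish at 1. *)
Lemma retraction_framing (K : numFieldType) (L : lieSuperType K) (V : lmodType K)
    (R : uea L -> V) (J : finType) (E : J -> L) (c : J -> {linear V -> K^o}) :
  linear R -> (forall x, \sum_j c j (R (uin x)) *: E j = x) ->
  exists G : J -> uform L, framing E G.
Proof.
move=> Rlin Rx.
have lin j a u v : c j (R (a *: u + v)) - c j (R 1) * counit L (a *: u + v)
  = a * (c j (R u) - c j (R 1) * counit L u) + (c j (R v) - c j (R 1) * counit L v).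
  by rewrite Rlin linearP /= form_lin /GRing.scale /=; ring.
exists (fun j => Form (lin j)); split=> [j|x] /=.
  by rewrite counit1 mulr1 subrr.
rewrite -[RHS]Rx; apply: eq_bigr => j _.
by rewrite -[uin x]mulr1 counit_inM mulr0 subr0 mulr1.
Qed.

(** * The algebras q(n) and pq(n) *)

Section Frames.
Variables (K : numFieldType) (n : nat).
Local Notation Q := (q K n).
Implicit Types (x y m : Q).

Definition q_basis (j : bool * ('I_n * 'I_n)) : Q :=
  if j.1 then (0, delta_mx j.2.1 j.2.2) else (delta_mx j.2.1 j.2.2, 0).

Definition q_coord (j : bool * ('I_n * 'I_n)) x : K^o :=
  if j.1 then x.2 j.2.1 j.2.2 else x.1 j.2.1 j.2.2.

Fact q_coord_is_linear j : linear (q_coord j).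
Proof. by move=> c x y; rewrite /q_coord; case: j.1; rewrite !mxE. Qed.
HB.instance Definition _ j :=
  GRing.isLinear.Build K Q K^o *:%R (q_coord j) (q_coord_is_linear j).

Lemma q_coordK x : \sum_j q_coord j x *: q_basis j = x.
Proof.
rewrite -(pair_big xpredT xpredT (fun b p => q_coord (b, p) x *: q_basis (b, p))) /=.
rewrite big_bool /= [LHS]surjective_pairing; case: x => A B.
rewrite !linearD !linear_sum /=; congr pair.
  rewrite big1 ?add0r => [|p _]; last by rewrite scaler0.
  by rewrite {2}[A]matrix_sum_delta pair_bigA.
rewrite addrC big1 ?add0r => [|p _]; last by rewrite scaler0.
by rewrite {2}[B]matrix_sum_delta pair_bigA.
Qed.

(** Left multiplication in the associative superalgebra of matrices X_{A,B}; the
    orbit map of the identity recovers x from its action. *)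
Definition qmul x m : Q :=
  (x.1 *m m.1 + x.2 *m m.2, x.1 *m m.2 + x.2 *m m.1).

Fact qmul_action : @lie_action K _ Q (fun _ => True) qmul.
Proof.
split=> // [x c v w _ _|v c x y _|a b x y v _].
- by congr pair; rewrite /= !mulmxDr -!scalemxAr scalerDr addrACA.
- by congr pair; rewrite /= !mulmxDl -!scalemxAl scalerDr addrACA.
case: a b => [] []; rewrite /qmul /=; congr pair => /=;
  rewrite ?(mulmx0, mul0mx, add0r, addr0, expr0, expr1, scale1r, scaleN1r, opprK,
    subrr, oppr0, subr0) ?mulmxDl ?mulNmx ?mulmxA //.
Qed.

Lemma q_framing : exists (J : finType) (E : J -> Q) (G : J -> uform Q), framing E G.
Proof.
exists _, q_basis.
apply: (@retraction_framing _ _ _ (fun u => mact qmul u ((1%:M, 0) : Q)) _ _ q_coord).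
  by move=> c u v; rewrite (mact_linl qmul_action).
move=> x; rewrite (mact_in qmul_action) // -[RHS]q_coordK; apply: eq_bigr => j _.
by congr (q_coord j _ *: _); case: x => A B; rewrite /qmul /= !mulmx1 !mulmx0 addr0 add0r.
Qed.

Lemma q_scalar_sbrl x m : x \in ideal_pred (q_scalar_ideal K n) -> sbr x m = 0.
Proof.
case/asboolP=> c ->; rewrite sbrZl; suff -> : sbr ((1%:M, 0) : Q) m = 0.
  exact: scaler0.
by congr pair; rewrite /= !(mulmx1, mul1mx, mulmx0, mul0mx, subrr, addr0).
Qed.

(** Multiplication of matrices does not descend to pq(n), since the identity acts
    as 1; the adjoint action on q(n) does. *)
Definition pq_ad (u : pq K n) m : Q := sbr (repr (u : lquot _)) m.

Lemma pq_adE x m : pq_ad (lpi _ x) m = sbr x m.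
Proof.
apply/eqP; rewrite -subr_eq0 -scaleN1r -sbrZl scaleN1r -sbrDl.
by rewrite q_scalar_sbrl //; exact: repr_lpi.
Qed.

Fact pq_ad_action : @lie_action K (pq K n) Q (fun _ => True) pq_ad.
Proof.
have [pl ph ps] := lpi_lsmorph (q_scalar_ideal K n).
split=> // [x c v w _ _|v c x y _|a b x y v _]; first exact: linearP.
  have [{}x ->] := lpi_surj x; have [{}y ->] := lpi_surj y.
  by rewrite -pl !pq_adE sbrDl sbrZl.
have [{}x ->] := lpi_surj x; have [{}y ->] := lpi_surj y.
by rewrite -!ph -ps !pq_adE sbr_jacobi addrK.
Qed.

Lemma delta_mul_delta (A : 'M[K]_n) (i j : 'I_n) :
  delta_mx i j *m A *m delta_mx j i = A j j *: delta_mx i i.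
Proof.
rewrite -(mul_delta_mx (0 : 'I_1) i j) -(mul_delta_mx (0 : 'I_1) j i) !mulmxA.
rewrite -(mulmxA _ _ A) -rowE -(mulmxA _ (row j A)) -colE.
have -> : col j (row j A) = (A j j)%:M.
  by apply/matrixP => a b; rewrite !ord1 !mxE eqxx.
by rewrite mul_mx_scalar -scalemxAl mul_delta_mx.
Qed.

Lemma sum_commutators (A : 'M[K]_n) :
  \sum_i \sum_j (A *m delta_mx i j - delta_mx i j *m A) *m delta_mx j i
  = n%:R *: A - (\tr A)%:M.
Proof.
have inner i : \sum_j (A *m delta_mx i j - delta_mx i j *m A) *m delta_mx j i
    = n%:R *: (A *m delta_mx i i) - \tr A *: delta_mx i i.
  rewrite (eq_bigr (fun j => A *m delta_mx i i - A j j *: delta_mx i i)) => [|j _].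
    by rewrite sumrB sumr_const card_ord -scaler_suml scaler_nat.
  by rewrite mulmxBl -mulmxA mul_delta_mx delta_mul_delta.
rewrite (eq_bigr _ (fun i _ => inner i)) sumrB -!scaler_sumr -mulmx_sumr.
by rewrite -mx1_sum_delta mulmx1 scalemx1.
Qed.

(** Recovers x = (A, B) up to scalars from its adjoint action: the sum over the
    matrix units E_ij of [A, E_ij] E_ji is n A - tr A, and the bracket of x with
    (0, 1) is (2 B, 0). *)
Definition pq_retract (u : uea (pq K n)) : Q :=
  (n%:R^-1 *: \sum_i \sum_j
     (mact pq_ad u ((delta_mx i j, 0) : Q)).1 *m delta_mx j i,
   2^-1 *: (mact pq_ad u ((0, 1%:M) : Q)).1).

Fact pq_retract_linear : linear pq_retract.
Proof.
move=> c u v; rewrite /pq_retract !(mact_linl pq_ad_action) //; congr pair => /=.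
  rewrite scalerA mulrC -scalerA -scalerDr; congr (_ *: _).
  rewrite scaler_sumr -big_split; apply: eq_bigr => i _ /=.
  rewrite scaler_sumr -big_split; apply: eq_bigr => j _ /=.
  by rewrite (mact_linl pq_ad_action) //= mulmxDl -scalemxAl.
by rewrite scalerDr !scalerA mulrC.
Qed.

Lemma pq_retract_in x : (0 < n)%N ->
  pq_retract (uin (lpi _ x)) = x - (n%:R^-1 * \tr x.1) *: (1%:M, 0).
Proof.
move=> n0; have nK : n%:R != 0 :> K by rewrite pnatr_eq0 -lt0n.
rewrite /pq_retract (mact_in pq_ad_action) // pq_adE; case: x => A B.
congr pair => /=.
  rewrite (eq_bigr (fun i => \sum_j (A *m delta_mx i j - delta_mx i j *m A) *m delta_mx j i)).
    by rewrite sum_commutators scalerBr scalerA mulVf // scale1r -[(\tr A)%:M]scalemx1 scalerA.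
  move=> i _; apply: eq_bigr => j _.
  by rewrite (mact_in pq_ad_action) // pq_adE /= mulmx0 mul0mx !addr0.
rewrite mulmx0 mul0mx subrr add0r mulmx1 mul1mx -mulr2n -scaler_nat scalerA.
by rewrite mulVf ?pnatr_eq0 // scale1r scaler0 subr0.
Qed.

Lemma pq_framing : (0 < n)%N ->
  exists (J : finType) (E : J -> pq K n) (G : J -> uform (pq K n)), framing E G.
Proof.
move=> n0; exists _, (fun j => lpi _ (q_basis j) : pq K n).
apply: (@retraction_framing _ _ _ pq_retract _ _ q_coord pq_retract_linear) => u.
have [x ->] := lpi_surj u; rewrite pq_retract_in //.
rewrite (eq_bigr (fun j => lpi _ (q_coord j
  (x - (n%:R^-1 * \tr x.1) *: (1%:M, 0)) *: q_basis j))) => [|j _]; last first.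
  by move: (x - _) => w; exact: lpiZ.
rewrite -linear_sum q_coordK; apply/lpiP; apply/asboolP.
by exists (- (n%:R^-1 * \tr x.1)); rewrite addrAC subrr add0r scaleNr.
Qed.

End Frames.

(** * Nondegenerate forms *)

Section Forms.
Variables (K : numFieldType) (n : nat).
Local Notation Q := (q K n).
Implicit Types (x y m : Q) (d : 'rV[K]_n).

Definition q_form d x : K^o := \tr (diag_mx d *m x.1).

Fact q_form_is_linear d : linear (q_form d).
Proof. by move=> c x y; rewrite /q_form /= mulmxDr -scalemxAr mxtraceD mxtraceZ. Qed.
HB.instance Definition _ d :=
  GRing.isLinear.Build K Q K^o *:%R (q_form d) (q_form_is_linear d).

Lemma q_form_scalar d x : \sum_i d 0 i = 0 -> x \in ideal_pred (q_scalar_ideal K n) ->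
  q_form d x = 0.
Proof.
move=> d0 /asboolP[c ->]; rewrite linearZ /= /q_form mulmx1 mxtrace_diag d0.
exact: mulr0.
Qed.

(** For diagonal D, the entries of DB + BD are (d_i + d_j) B_ij; hence the
    equation tr (D (BB' + B'B)) = g(B') + c tr B' is solved entrywise. *)
Lemma anticommutator_form d (g : {linear 'M[K]_n -> K^o}) c (B' : 'M[K]_n) :
  (forall i j, d 0 i + d 0 j != 0) ->
  let B := \matrix_(i, j) ((g (delta_mx j i) + c *+ (i == j)) / (d 0 i + d 0 j)) in
  \tr (diag_mx d *m (B *m B' + B' *m B)) = g B' + c * \tr B'.
Proof.
move=> dn0 B.
have -> : \tr (diag_mx d *m (B *m B' + B' *m B))
    = \sum_i \sum_j (d 0 i + d 0 j) * B i j * B' j i.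
  rewrite mulmxDr mxtraceD /mxtrace.
  rewrite (eq_bigr (fun i => \sum_j d 0 i * B i j * B' j i)); last first.
    move=> i _; rewrite mul_diag_mx !mxE mulr_sumr.
    by apply: eq_bigr => j _; rewrite mulrA.
  rewrite [X in _ + X](eq_bigr (fun i => \sum_j d 0 i * B j i * B' i j)); last first.
    move=> i _; rewrite mul_diag_mx !mxE mulr_sumr.
    by apply: eq_bigr => j _; rewrite [B' i j * _]mulrC mulrA.
  rewrite [X in _ + X]exchange_big -big_split; apply: eq_bigr => i _ /=.
  by rewrite -big_split; apply: eq_bigr => j _ /=; rewrite !mulrDl.
transitivity (\sum_i \sum_j (g (delta_mx j i) * B' j i + (c *+ (i == j)) * B' j i)).
  apply: eq_bigr => i _; apply: eq_bigr => j _.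
  by rewrite mxE mulrCA mulfV ?dn0 // mulr1 mulrDl.
under eq_bigr => i _ do rewrite big_split /=.
rewrite big_split /=; congr (_ + _).
  rewrite {2}[B']matrix_sum_delta exchange_big linear_sum; apply: eq_bigr => i _.
  by rewrite linear_sum; apply: eq_bigr => j _; rewrite linearZ /= mulrC.
rewrite /mxtrace mulr_sumr; apply: eq_bigr => i _.
rewrite (bigD1 i) //= eqxx mulr1n big1 ?addr0 // => j /negbTE ji.
by rewrite eq_sym ji mulr0n mul0r.
Qed.

End Forms.

(** * The hyperplanes sq(n) and psq(n) *)

Section SqHyperplane.
Variables (K : numFieldType) (n : nat).
Hypothesis n_gt0 : (0 < n)%N.
Local Notation Q := (q K n).
Local Notation S := (sq K n).
Implicit Types (x : Q) (y : S).

Fact n_neq0 : n%:R != 0 :> K. Proof. by rewrite pnatr_eq0 -lt0n. Qed.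

Definition odd_trace x : K^o := n%:R^-1 * \tr x.2.

Fact odd_trace_is_linear : linear odd_trace.
Proof. by move=> c x y; rewrite /odd_trace /= mxtraceD mxtraceZ mulrDr mulrCA. Qed.
HB.instance Definition _ :=
  GRing.isLinear.Build K Q K^o *:%R odd_trace odd_trace_is_linear.

Definition odd_one : Q := (0, 1%:M).

Fact sq_proj_subproof x : x - odd_trace x *: odd_one \in @sq_pred K n.
Proof.
rewrite inE /= linearB linearZ /= mxtrace1 /odd_trace mulrAC mulVf ?n_neq0 //.
by rewrite mul1r subrr.
Qed.
Definition sq_proj x : S := Sq (sq_proj_subproof x).

Fact sq_proj_is_linear : linear sq_proj.
Proof.
move=> c x y; apply/val_inj => /=.
rewrite linearP /=; move: (odd_trace x) (odd_trace y) => a b.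
by rewrite scalerDl scalerBr scalerA opprD addrACA.
Qed.
HB.instance Definition _ :=
  GRing.isLinear.Build K Q S *:%R sq_proj sq_proj_is_linear.

Lemma sq_hyperplane : odd_hyperplane (@sq_val K n) sq_proj odd_trace odd_one.
Proof.
have tr0 y : odd_trace (sq_val y) = 0.
  by rewrite /odd_trace (eqP (sq_valP y)) mulr0.
split=> [||||||x x'].
- exact: sq_val_lsmorph.
- by move=> y; apply/val_inj; rewrite /= tr0 scale0r subr0.
- by [].
- by move=> x; rewrite /= subrK.
- exact: tr0.
- by rewrite -[LHS]/(n%:R^-1 * \tr (1%:M : 'M[K]_n)) mxtrace1 mulVf // n_neq0.
rewrite -[LHS]/(n%:R^-1 * \tr (q_sbr x x').2) /= mxtraceD !linearB /=.
rewrite ![\tr (x'.1 *m _)]mxtrace_mulC ![\tr (x'.2 *m _)]mxtrace_mulC.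
by rewrite !subrr addr0 mulr0.
Qed.

Lemma psq_hyperplane : exists r h H, odd_hyperplane (@psq_incl K n) r h H.
Proof.
have [|x /asboolP[c ->]|r [h oh]] := odd_hyperplane_quot (i' := @psq_incl K n)
  (I := q_scalar_ideal K n) (J := sq_scalar_ideal K n) sq_hyperplane (psq_incl_lsmorph K n).
- exact: psq_incl_lpi.
- rewrite !linearZ /=; have t0 : odd_trace (1%:M, 0) = 0 by rewrite /odd_trace mxtrace0 mulr0.
  rewrite t0; split; first exact: mulr0.
  by apply/asboolP; exists c; rewrite /= t0 scale0r subr0.
by exists r, h, (lpi (q_scalar_ideal K n) odd_one).
Qed.

Variable d : 'rV[K]_n.
Hypothesis d_neq0 : forall i j, d 0 i + d 0 j != 0.

Lemma hom_q_odd x : hom true x -> x = (0, x.2).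
Proof. by move=> <-. Qed.

Lemma q_nondeg : odd_nondeg (q_form d).
Proof.
move=> g.
have lin : linear (fun B => g ((0, B) : Q) : K^o).
  by move=> c B B'; rewrite -linearP; congr (g _); congr pair; rewrite /= scaler0 addr0.
pose g0 : {linear 'M[K]_n -> K^o} := HB.pack_for {linear 'M[K]_n -> K^o}
  (fun B => g ((0, B) : Q) : K^o) (GRing.isLinear.Build K 'M[K]_n K^o *:%R _ lin).
pose B := \matrix_(i, j) ((g0 (delta_mx j i) + 0 *+ (i == j)) / (d 0 i + d 0 j)).
exists ((0, B) : Q); split=> // x hx; rewrite (hom_q_odd hx); move: x.2 => B'.
transitivity (\tr (diag_mx d *m (B *m B' + B' *m B))).
  by rewrite /q_form /= mul0mx subr0 add0r.
by rewrite (anticommutator_form g0 0 B' d_neq0) mul0r addr0.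
Qed.

(** Within sq(n) the matrix B solving the equation above has to be traceless;
    this fixes the free constant c, provided the inverse of D has nonzero
    trace. *)
Lemma sq_nondeg : \sum_i (d 0 i)^-1 != 0 -> odd_nondeg (fun y : S => q_form d (sq_val y)).
Proof.
move=> trD g.
have lin : linear (fun B => g (sq_proj ((0, B) : Q)) : K^o).
  move=> c B B'; rewrite -!linearP; congr (g (sq_proj _)).
  by congr pair; rewrite /= scaler0 addr0.
pose g0 : {linear 'M[K]_n -> K^o} := HB.pack_for {linear 'M[K]_n -> K^o}
  (fun B => g (sq_proj ((0, B) : Q)) : K^o)
  (GRing.isLinear.Build K 'M[K]_n K^o *:%R _ lin).
pose c : K := - (\sum_i g0 (delta_mx i i) / (d 0 i + d 0 i)) * 2 / \sum_i (d 0 i)^-1.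
pose B := \matrix_(i, j) ((g0 (delta_mx j i) + c *+ (i == j)) / (d 0 i + d 0 j)).
have B0 : ((0, B) : Q) \in @sq_pred K n.
  rewrite inE /= /mxtrace.
  rewrite (eq_bigr (fun i => g0 (delta_mx i i) / (d 0 i + d 0 i) + c / 2 * (d 0 i)^-1)).
    rewrite big_split -mulr_sumr /= /c; move: trD; move: (\sum_i (d 0 i)^-1) => T T0.
    by move: (\sum_i _ / _) => Sg; apply/eqP; field.
  move=> i _; rewrite mxE eqxx mulr1n mulrDl; congr (_ + _).
  by rewrite -mulr2n -(mulr_natl (d 0 i)) invfM mulrA.
exists (Sq B0); split; first exact: val_inj.
move=> y /(congr1 (@sq_val K n))/esym hy.
have yE : y = sq_proj ((0, (sq_val y).2) : Q).
  by rewrite -[LHS](oh_retract sq_hyperplane) /= {1}hy.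
rewrite [in RHS]yE -[RHS]/(g0 (sq_val y).2).
transitivity (\tr (diag_mx d *m (B *m (sq_val y).2 + (sq_val y).2 *m B))).
  rewrite -[LHS]/(q_form d (q_sbr (0, B) (sq_val y))) {1}hy /q_form /=.
  by rewrite mul0mx subr0 add0r.
by rewrite (anticommutator_form g0 c _ d_neq0) (eqP (sq_valP y)) mulr0 addr0.
Qed.

End SqHyperplane.

(** * The centres *)

Section Centers.
Variable K : numFieldType.

Lemma supercenter_q n : (0 < n)%N ->
  supercenter (q K n) = (umap (@sq_val K n) @` supercenter (sq K n))%classic.
Proof.
move=> n0; have [J [E [G EG]]] := q_framing K n.
pose d : 'rV[K]_n := const_mx 1.
have dd i j : d 0 i + d 0 j != 0 by rewrite !mxE -mulr2n pnatr_eq0.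
apply: (supercenter_hyperplane (sq_hyperplane K n0) EG (q_nondeg dd)).
apply: (sq_nondeg n0 dd); rewrite (eq_bigr (fun=> 1)) => [|i _].
  by rewrite sumr_const card_ord pnatr_eq0 -lt0n.
by rewrite mxE invr1.
Qed.

(** A form tr (D A) descends to pq(n) when tr D = 0, and the one used here is
    given by D = diag(-n, 1, ..., 1) of size n + 1. The sums of two entries are
    -2n, 1 - n and 2, so they are nonzero when n > 1. In size 2 there is no such
    D: a traceless diag(a, -a) has an entry sum equal to 0. *)
Definition traceless_diag n : 'rV[K]_n.+1 :=
  \row_i (if i == ord0 then - n%:R else 1).

Lemma traceless_diag_sum n : \sum_i traceless_diag n 0 i = 0.
Proof.
rewrite big_ord_recl mxE eqxx (eq_bigr (fun=> 1)) => [|i _]; last by rewrite mxE.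
by rewrite sumr_const card_ord addNr.
Qed.

Lemma traceless_diag_inv n : (1 < n)%N -> \sum_i (traceless_diag n 0 i)^-1 != 0.
Proof.
move=> n1; rewrite big_ord_recl mxE eqxx (eq_bigr (fun=> 1)) => [|i _]; last first.
  by rewrite mxE /= invr1.
have nK : n%:R != 0 :> K by rewrite pnatr_eq0 -lt0n ltnW.
rewrite sumr_const card_ord invrN addrC subr_eq0; apply/negP => /eqP e.
have : (n * n)%:R = 1%:R :> K by rewrite natrM {2}e mulfV.
by move/eqP; rewrite eqr_nat muln_eq1 => /andP[/eqP n1' _]; rewrite n1' in n1.
Qed.

Lemma traceless_diag_neq0 n i j : (1 < n)%N ->
  traceless_diag n 0 i + traceless_diag n 0 j != 0.
Proof.
move=> n1; rewrite !mxE; case: (i == _); case: (j == _).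
- by rewrite -opprD oppr_eq0 -mulr2n mulrn_eq0 pnatr_eq0 /= -lt0n ltnW.
- by rewrite addrC subr_eq0 eq_sym (eqr_nat K n 1) gtn_eqF.
- by rewrite subr_eq0 eq_sym (eqr_nat K n 1) gtn_eqF.
by rewrite -mulr2n pnatr_eq0.
Qed.

Lemma supercenter_pq n : (2 < n)%N ->
  supercenter (pq K n) = (umap (@psq_incl K n) @` supercenter (psq K n))%classic.
Proof.
case: n => // n n2; have n0 : (0 < n.+1)%N by [].
have [J [E [G EG]]] := pq_framing K n0.
have [r [h [H oh]]] := psq_hyperplane K n0.
pose d := traceless_diag n.
have dd i j : d 0 i + d 0 j != 0 by exact: traceless_diag_neq0.
have [l lE] := lquot_lift (fun x => q_form_scalar (traceless_diag_sum n) (x := x)).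
apply: (supercenter_hyperplane oh EG (l := l)).
  exact: odd_nondeg_quot lE (q_nondeg dd).
apply: odd_nondeg_quot (sq_nondeg n0 dd (traceless_diag_inv n2)).
by move=> y /=; rewrite psq_incl_lpi lE.
Qed.

End Centers.

Local Open Scope classical_set_scope.
Local Open Scope complex_scope.

Theorem corollary13p3 (R : realType) :
  (forall n : nat, (2 <= n)%N ->
     supercenter (q R[i] n)
     = umap (@sq_val R[i] n) @` supercenter (sq R[i] n)) /\
  (forall n : nat, (3 <= n)%N ->
     supercenter (pq R[i] n)
     = umap (@psq_incl R[i] n) @` supercenter (psq R[i] n)).
Proof.
split=> n n_ge; last exact: supercenter_pq.
by apply: supercenter_q; exact: ltnW.
Qed.
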